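(* Let $\mathbb{X}$ be a Banach space, let $A:D(A)\subset\mathbb{X}\to\mathbb{X}$ be a linear (possibly unbounded) operator which generates an exponentially stable $C_0$-semigroup $(T(t))_{t\ge 0}$ on $\mathbb{X}$, let $p\geq 1$, and let $f:\mathbb{R}\to\mathbb{X}$ be Weyl almost periodic of degree $p$. Then there exists a unique bounded mild solution $u:\mathbb{R}\to\mathbb{X}$ to $$u'(t)=Au(t)+f(t),\qquad t\in\mathbb{R}.$$ This solution is Weyl almost periodic of degree $p$ and is given by $$u(t)=\int_{-\infty}^{t}T(t-s)f(s)\,ds,\qquad t\in\mathbb{R}.$$
   Context: The semigroup $(T(t))_{t\ge0}$ is exponentially stable if there exist $\delta>0$ and $M\ge1$ such that $\|T(t)\|\le Me^{-\delta t}$ for all $t\ge0$. A function $u:\mathbb{R}\to\mathbb{X}$ is a mild solution to $u'(t)=Au(t)+f(t)$ if for every $a\in\mathbb{R}$ and all $t\ge a$, $u(t)=T(t-a)u(a)+\int_a^t T(t-s)f(s)\,ds$. A set $T\subset\mathbb{R}$ is relatively dense if there is a real $k>0$ such that $T\cap[a,a+k]\neq\emptyset$ for all $a\in\mathbb{R}$. A function $g\in L^{p}_{\mathrm{loc}}(\mathbb{R},\mathbb{X})$ is Weyl almost periodic of degree $p$ if for every $\varepsilon>0$ there exists $l=l(\varepsilon)>0$ such that the set $$\Big\{\tau\in\mathbb{R}:\ \sup_{\xi\in\mathbb{R}}\Big(\frac1l\int_{\xi}^{\xi+l}\|g(t+\tau)-g(t)\|^{p}\,dt\Big)^{1/p}<\varepsilon\Big\}$$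 is relatively dense. *)

(* Defs.v *)
From HB Require Import structures.
From mathcomp Require Export all_boot all_order all_algebra.
From mathcomp Require Export all_classical all_reals all_analysis.
Set Implicit Arguments.
Unset Strict Implicit.
Unset Printing Implicit Defensive.
Export Order.TTheory GRing.Theory Num.Theory.
Export numFieldNormedType.Exports.
#[global] Open Scope classical_set_scope.
#[global] Open Scope ring_scope.

Section Bochner.
Context {d : measure_display} {S : measurableType d} {R : realType}.
Context {X : completeNormedModType R}.
Variable mu : {measure set S -> \bar R}.
Implicit Types (D : set S) (f : S -> X).

Definition simple_function (s : S -> X) : Prop :=
  finite_set (range s) /\ forall x : X, measurable (s @^-1` [set x]).

Definition integrable_simple D (s : S -> X) : Prop :=
  simple_function s /\
  forall x : X, x != 0 -> (mu (D `&` s @^-1` [set x]) < +oo)%E.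

(* For an integrable simple function only the value 0 can be taken on a set of
   infinite measure, and then [fine +oo = 0] multiplies the zero vector. *)
Definition simple_integral D (s : S -> X) : X :=
  \sum_(x \in range s) fine (mu (D `&` s @^-1` [set x])) *: x.

(* The exceptional null set makes [f] measurable for the completion of [mu]
   only. The library integral of a nonnegative function is a supremum over
   measurable simple functions below it, so on norms of such functions it agrees
   with the integral for the completed measure. *)
Definition strongly_measurable D f : Prop :=
  exists s : nat -> S -> X, (forall n, simple_function (s n)) /\
    {ae mu, forall t, D t -> s n t @[n --> \oo] --> f t}.

Definition L1_approximation D f (s : nat -> S -> X) : Prop :=
  (forall n, integrable_simple D (s n)) /\
  (\int[mu]_(t in D) (`|f t - s n t|)%:E)%E @[n --> \oo] --> 0%E.

Definition bochner_integrable D f : Prop :=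
  strongly_measurable D f /\ exists s, L1_approximation D f s.

(* The limit does not depend on the approximating sequence; the value is only
   meaningful for Bochner integrable functions (and is 0 if there is no limit). *)
Definition bochner_integral D f : X :=
  xget 0 [set v : X | exists s, L1_approximation D f s /\
                        simple_integral D (s n) @[n --> \oo] --> v].

End Bochner.

Section Semigroups.
Context {R : realType} {X : completeNormedModType R}.

Definition op_norm (L : X -> X) : \bar R :=
  ereal_sup [set (`|L x|)%:E | x in [set x : X | `|x| <= 1]].

(* Only the operators [T t] with [0 <= t] matter. *)
Definition C0_semigroup (T : R -> X -> X) : Prop :=
  [/\ forall t : R, 0 <= t -> linear (T t) /\ continuous (T t),
      T 0 = id,
      forall t s : R, 0 <= t -> 0 <= s -> T (t + s) = T t \o T s &
      forall x, T h x @[h --> 0^'+] --> x].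

(* An unbounded operator is a pair of a domain [DA] and a map [A] whose values
   outside [DA] are irrelevant. *)
Definition linear_operator (DA : set X) (A : X -> X) : Prop :=
  DA 0 /\ forall (c : R) x y, DA x -> DA y ->
    DA (c *: x + y) /\ A (c *: x + y) = c *: A x + A y.

Definition generates (DA : set X) (A : X -> X) (T : R -> X -> X) : Prop :=
  [/\ C0_semigroup T,
      DA = [set x | cvg (h^-1 *: (T h x - x) @[h --> 0^'+])] &
      forall x, DA x -> A x = lim (h^-1 *: (T h x - x) @[h --> 0^'+])].

Definition exponentially_stable (T : R -> X -> X) : Prop :=
  exists delta M : R, [/\ 0 < delta, 1 <= M &
    forall t : R, 0 <= t -> (op_norm (T t) <= (M * expR (- delta * t))%:E)%E].

(* Mild solutions of [u' = A u + f], where [A] generates [T]. *)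
Definition mild_solution (T : R -> X -> X) (f u : R -> X) : Prop :=
  forall a t : R, a <= t ->
    bochner_integrable lebesgue_measure `[a, t] (fun s : R => T (t - s) (f s)) /\
    u t = T (t - a) (u a) +
          bochner_integral lebesgue_measure `[a, t] (fun s : R => T (t - s) (f s)).

End Semigroups.

Section Weyl.
Context {R : realType} {X : completeNormedModType R}.

Definition relatively_dense (E : set R) : Prop :=
  exists2 k : R, 0 < k & forall a : R, E `&` `[a, a + k] !=set0.

Definition locally_Lp (p : R) (g : R -> X) : Prop :=
  strongly_measurable lebesgue_measure setT g /\
  forall a b : R,
    (\int[lebesgue_measure]_(t in `[a, b]) (`|g t| `^ p)%:E < +oo)%E.

Definition weyl_dist (p l tau : R) (g : R -> X) : \bar R :=
  ereal_sup (range (fun xi : R =>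
    (((l^-1)%R%:E * \int[lebesgue_measure]_(t in `[xi, (xi + l)%R])
                   (`|g (t + tau) - g t| `^ p)%R%:E) `^ (p^-1)%R)%E)).

Definition weyl_almost_periodic (p : R) (g : R -> X) : Prop :=
  locally_Lp p g /\
  forall eps : R, 0 < eps -> exists2 l : R, 0 < l &
    relatively_dense [set tau | (weyl_dist p l tau g < eps%:E)%E].

End Weyl.

(* Main.v *)
From mathcomp Require Import finmap.
From HB Require Import structures.
Require Import Defs.
From mathcomp Require Import measurable_realfun simple_functions ring lra zify.

(** The solution is the integral of [T (t - s) (f s)] over the past of [t].
    Let [|T t| <= M exp (- delta t)].

    A Weyl almost periodic [f] has integrals of [|f|] over windows of some fixed
    length that are bounded uniformly in the position of the window: an almost
    period moves any window into one fixed compact interval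
    ([weyl_window_bounded]). Summing the exponentially weighted windows that
    cover the half-line shows that the integral over the past converges and is
    bounded in [t] ([exp_weight_window], [norm_past_integral_le]). Splitting the
    past of [t] at [a] and taking the bounded operator [T (t - a)] out of the
    integral over the past of [a] gives the equation of mild solutions
    ([past_integral_step]). If [w] is the difference of two bounded mild
    solutions, then [w t = T (t - a) (w a)] for all [a <= t], and letting [a]
    tend to minus infinity gives [w = 0] ([bounded_mild_solution_unique]).

    For almost periodicity, a translation of the half-line bounds the increment
    of the solution by the convolution of the exponential weight with the
    increment of [f] ([norm_past_integral_translate_le]). Jensen's inequality
    moves the p-th power inside this weighted average, and Tonelli's theorem
    leaves averages of the p-th power over translated windows
    ([exp_conv_window_Lp]). Hence an almost period of [f] for a small tolerance
    is one of the solution, for the same window length. The solution is strongly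
    measurable because it is continuous from the right and is therefore the
    limit of its compositions with step functions that converge to the identity
    from above.

    These arguments use the Bochner integral through the following facts: a
    limit of step functions with integrable norm is Bochner integrable
    ([L1_approximation_exists], by cutting the step functions off), its integral
    does not depend on the approximation ([simple_integral_lim_unique]), is
    additive, commutes with bounded operators and with translations, and is
    dominated by the integral of the norm. All of them reduce to step
    functions, whose integral can be computed along any finer partition
    ([simple_integral_comp]). Since [f] is only almost everywhere a limit of
    step functions, it is replaced by an everywhere limit [g]. *)

Set Implicit Arguments.
Unset Strict Implicit.
Unset Printing Implicit Defensive.

(** * Step functions *)

Section SimpleMaps.
Context {d : measure_display} {S : measurableType d}.

(** The codomain is arbitrary, so that scalar, vector and operator-valued
    step functions can be paired and mapped uniformly. *)
Definition simple_map {Y : Type} (s : S -> Y) : Prop :=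
  finite_set (range s) /\ forall y : Y, measurable (s @^-1` [set y]).

Lemma simple_map_measurable {Y : Type} (s : S -> Y) (B : set Y) :
  simple_map s -> measurable (s @^-1` B).
Proof.
move=> [fs ms].
have -> : s @^-1` B = \bigcup_(y in range s `&` B) (s @^-1` [set y]).
  apply/seteqP; split => [t Bt|t [y [_ By] sty]]; last by rewrite /= sty.
  by exists (s t) => //; split => //; exists t.
apply: fin_bigcup_measurable => //.
by apply: (@sub_finite_set _ _ (range s)) fs; exact: subIsetl.
Qed.

Lemma simple_map_comp {Y Z : Type} (phi : Y -> Z) (s : S -> Y) :
  simple_map s -> simple_map (phi \o s).
Proof.
move=> ss; split; last by move=> z; exact: (simple_map_measurable (phi @^-1` [set z])).
by rewrite -(image_comp s phi); apply: finite_image; exact: (proj1 ss).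
Qed.

Lemma simple_map_pair {Y Z : Type} (s : S -> Y) (r : S -> Z) :
  simple_map s -> simple_map r -> simple_map (fun t => (s t, r t)).
Proof.
move=> [fs ms] [fr mr]; split.
  apply: (@sub_finite_set _ _ (range s `*` range r)); last exact: finite_setX.
  by move=> _ [t _ <-]; split; exists t.
move=> [y z].
have -> : (fun t => (s t, r t)) @^-1` [set (y, z)] =
    (s @^-1` [set y]) `&` (r @^-1` [set z]).
  by apply/seteqP; split => t /= [-> ->].
exact: measurableI.
Qed.

Lemma simple_map2 {Y Z W : Type} (phi : Y -> Z -> W) (s : S -> Y) (r : S -> Z) :
  simple_map s -> simple_map r -> simple_map (fun t => phi (s t) (r t)).
Proof.
move=> ss sr.
exact: (simple_map_comp (fun p => phi p.1 p.2) (simple_map_pair ss sr)).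
Qed.

Lemma simple_map_mem (A : set S) :
  measurable A -> simple_map (fun t => t \in A).
Proof.
move=> mA; split; first exact: finite_finset.
case.
  rewrite (_ : _ @^-1` _ = A)//.
  by apply/seteqP; split => t /=; [move/set_mem|move/mem_set].
rewrite (_ : _ @^-1` _ = ~` A); first exact: measurableC.
apply/seteqP; split => t /=; first by move=> /negbT; rewrite notin_setE.
by rewrite -notin_setE => /negbTE.
Qed.

Lemma simple_map_restrict {Y : Type} (A : set S) (s : S -> Y) (y : Y) :
  measurable A -> simple_map s -> simple_map (fun t => if t \in A then s t else y).
Proof.
move=> mA; apply: (simple_map2 (fun b z => if b then z else y)).
exact: simple_map_mem.
Qed.

Lemma simple_map_measurable_fun {R : realType} {Y : Type} (s : S -> Y)
    (psi : Y -> R) (D : set S) : simple_map s -> measurable_fun D (psi \o s).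
Proof.
move=> ss mD B mB; apply: measurableI => //.
exact: (simple_map_measurable (psi @^-1` B)).
Qed.

End SimpleMaps.

(** * The integral of step functions *)

Section SimpleIntegral.
Context {d : measure_display} {S : measurableType d} {R : realType}.
Variable mu : {measure set S -> \bar R}.
Variables (D : set S) (mD : measurable D).

Lemma integral_simple_map {J : choiceType} (k : S -> J) (psi : J -> R) :
  simple_map k -> (forall j, 0 <= psi j) ->
  (\int[mu]_(t in D) (psi (k t))%:E =
   \sum_(j \in range k) (psi j)%:E * mu (D `&` k @^-1` [set j]))%E.
Proof.
move=> sk psi0; have [fk mk] := sk.
rewrite (eq_integral (fun t => \sum_(j \in range k)
    ((psi j)%:E * (\1_(k @^-1` [set j]) t)%:E))%E); last first.
  move=> t _; rewrite (fsbigD1 (k t))//=; last by exists t.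
  rewrite fsbig1; last first.
    move=> j [_ /= /eqP jk]; rewrite indicE memNset ?mule0//= => kj.
    by move: jk; rewrite -kj eqxx.
  by rewrite adde0 indicE mem_set ?mule1.
rewrite ge0_integral_fsum//; last 2 first.
- by move=> j; apply/measurable_EFinP; apply: measurable_funM.
- by move=> j t _; rewrite mule_ge0 ?lee_fin.
apply: eq_fsbigr => j _.
rewrite ge0_integralZl ?lee_fin//.
  by rewrite integral_indic// setIC.
by apply/measurable_EFinP; exact: measurable_indic.
Qed.


(** Both conditions ask that each fibre over a nonzero value be of finite
    measure; the norm formulation is stable under subtraction. *)
Lemma integrable_simpleP {X : completeNormedModType R} (s : S -> X) :
  simple_map s ->
  integrable_simple mu D s <-> (\int[mu]_(t in D) (`|s t|)%:E < +oo)%E.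
Proof.
move=> ss; have [fs ms] := ss.
have mDs x : measurable (D `&` s @^-1` [set x]) by exact: measurableI.
rewrite (integral_simple_map (psi := fun x => `|x|) ss)//.
split => [[_ fin]|lt].
  rewrite fsbig_finite//.
  apply: lte_sum_pinfty => x _.
  have [->|x0] := eqVneq x 0; first by rewrite normr0 mul0e.
  by apply: lte_mul_pinfty => //; exact: fin.
split => // x x0.
have [[t _ stx]|] := pselect (range s x); last first.
  move=> nx; rewrite [X in mu X](_ : _ = set0) ?measure0//.
  by rewrite -subset0 => t [_ st]; apply: nx; exists t.
move: lt; rewrite (fsbigD1 x)//=; last by exists t.
move=> /(le_lt_trans (leeDl _ _)) lt.
have {}lt : ((`|x|)%:E * mu (D `&` s @^-1` [set x]) < +oo)%E.
  by apply: lt; apply: fsume_ge0 => y _; rewrite mule_ge0.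
rewrite ltNge leye_eq; apply/eqP => mux; move: lt.
by rewrite mux gt0_muley ?ltxx// lte_fin normr_gt0.
Qed.

Lemma integrable_simple_function {X : completeNormedModType R} (s : S -> X) :
  integrable_simple mu D s -> simple_function s.
Proof. by case. Qed.

(** Computing the integral of a step function along any finer partition of the
    space: this is what makes the integral of step functions linear. *)
Lemma simple_integral_comp {J : choiceType} {X : completeNormedModType R}
    (k : S -> J) (phi : J -> X) :
  simple_map k ->
  (forall j, phi j != 0 -> (mu (D `&` k @^-1` [set j]) < +oo)%E) ->
  simple_integral mu D (phi \o k) =
  \sum_(j \in range k) fine (mu (D `&` k @^-1` [set j])) *: phi j.
Proof.
move=> sk fin; have [fk mk] := sk.
have [fp mp] := simple_map_comp phi sk.
(* Each value [x] is spread over the fibres of [k] that [phi] sends to [x]. *)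
pose c x j := if phi j == x then fine (mu (D `&` k @^-1` [set j])) *: phi j else 0.
transitivity (\sum_(x \in range (phi \o k)) \sum_(j \in range k) c x j).
  apply: eq_fsbigr => x _.
  have [->|x0] := eqVneq x 0.
    rewrite scaler0 fsbig1// => j _; rewrite /c; case: eqP => // ->.
    by rewrite scaler0.
  have -> : D `&` (phi \o k) @^-1` [set x] =
      \bigcup_(j in range k `&` phi @^-1` [set x]) (D `&` k @^-1` [set j]).
    apply/seteqP; split => t /=; last by move=> [j [_ /= <-]] [Dt <-].
    by move=> [Dt ktx]; exists (k t) => //; split => //; exists t.
  have fB : finite_set (range k `&` phi @^-1` [set x]).
    by apply: (@sub_finite_set _ _ (range k)) fk; exact: subIsetl.
  rewrite measure_fin_bigcup//; last 2 first.
  - by apply: trivIset_setIl; exact: trivIset_preimage1.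
  - by move=> j _; exact: measurableI.
  rewrite fsbig_mkcondr fsbig_finite// -sum_fine; last first.
    move=> j _; case: ifPn => // /[!inE] /= phij.
    by rewrite ge0_fin_numE// fin// phij.
  rewrite scaler_suml fsbig_finite//; apply: eq_bigr => j _; rewrite /c.
  case: ifPn => [/[!inE] /= ->|]; first by rewrite eqxx.
  by rewrite notin_setE/= => /eqP/negbTE ->; rewrite scale0r.
rewrite exchange_fsbig//; apply: eq_fsbigr => j /[!inE] -[t _ kt].
rewrite (fsbigD1 (phi j))//=; last by exists t => //=; rewrite kt.
rewrite /c eqxx fsbig1 ?addr0// => x [_ /= /eqP].
by rewrite eq_sym => /negbTE ->.
Qed.

End SimpleIntegral.

Section SimpleIntegralLaws.
Context {d : measure_display} {S : measurableType d} {R : realType}.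
Context {X : completeNormedModType R}.
Variable mu : {measure set S -> \bar R}.
Variables (D : set S) (mD : measurable D).

Lemma norm_simple_integral (s : S -> X) : integrable_simple mu D s ->
  ((`|simple_integral mu D s|)%:E <= \int[mu]_(t in D) (`|s t|)%:E)%E.
Proof.
move=> [ss fin]; have [fs ms] := ss.
rewrite (integral_simple_map (psi := fun x => `|x|) _ _ ss)//.
rewrite /simple_integral !fsbig_finite//.
rewrite (@le_trans _ _ (\sum_(x <- fset_set (range s))
    `|fine (mu (D `&` s @^-1` [set x])) *: x|)%:E)//.
  by rewrite lee_fin ler_norm_sum.
rewrite -sumEFin; apply: lee_sum => x _; have [->|x0] := eqVneq x 0.
  by rewrite scaler0 normr0 mul0e.
rewrite normrZ ger0_norm ?fine_ge0// EFinM muleC fineK//.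
by rewrite ge0_fin_numE// fin.
Qed.

Lemma measurable_norm_simple (s : S -> X) (E : set S) :
  simple_map s -> measurable_fun E (fun t => (`|s t|)%:E).
Proof.
move=> ss; apply/measurable_EFinP.
exact: (simple_map_measurable_fun (fun x => `|x|)).
Qed.

Lemma integrable_simpleB (s r : S -> X) :
  integrable_simple mu D s -> integrable_simple mu D r ->
  integrable_simple mu D (fun t => s t - r t).
Proof.
move=> is_ ir; have [ss _] := is_; have [sr _] := ir.
have ssr : simple_map (fun t => s t - r t).
  exact: (simple_map2 (fun x y => x - y)).
apply/(integrable_simpleP mu mD ssr).
move/(integrable_simpleP mu mD ss): is_ => is_.
move/(integrable_simpleP mu mD sr): ir => ir.
apply: le_lt_trans (lte_add_pinfty is_ ir).
rewrite -ge0_integralD//; last 2 first.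
- exact: measurable_norm_simple.
- exact: measurable_norm_simple.
apply: ge0_le_integral => //; first exact: measurable_norm_simple.
- by apply: emeasurable_funD; exact: measurable_norm_simple.
- by move=> t _; rewrite -EFinD lee_fin ler_normB.
Qed.

(** Both integrals are computed along the common partition of the space into
    the fibres of the pair [(s, r)]. *)
Lemma simple_integralB (s r : S -> X) :
  integrable_simple mu D s -> integrable_simple mu D r ->
  simple_integral mu D (fun t => s t - r t) =
  simple_integral mu D s - simple_integral mu D r.
Proof.
move=> is_ ir; have isr := integrable_simpleB is_ ir.
move: (is_) (ir) (isr) => [ss fs] [sr fr] [ssr fsr].
pose k t := (s t, r t); have sk : simple_map k by exact: simple_map_pair.
have mk j : measurable (D `&` k @^-1` [set j]).
  by apply: measurableI => //; case: sk.
have fin (phi : X * X -> X) : integrable_simple mu D (phi \o k) ->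
    forall j, phi j != 0 -> (mu (D `&` k @^-1` [set j]) < +oo)%E.
  move=> [sp fp] j /fp; apply: le_lt_trans; apply: le_measure; rewrite ?inE//; last by move=> t [Dt /= ->].
  by apply: measurableI => //; case: sp.
have E (phi : X * X -> X) := @simple_integral_comp _ _ _ mu _ mD _ X _ phi sk.
have Es : simple_integral mu D s = _ := E fst (fin fst is_).
have Er : simple_integral mu D r = _ := E snd (fin snd ir).
have Esr : simple_integral mu D (fun t => s t - r t) = _ :=
  E (fun j => j.1 - j.2) (fin (fun j => j.1 - j.2) isr).
have fk : finite_set (range k) by case: sk.
rewrite Es Er Esr !fsbig_finite// -sumrB.
by apply: eq_bigr => j _; rewrite scalerBr.
Qed.

Lemma integrable_simple_bounded (L : X -> X) (c : R) (s : S -> X) :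
  (forall x, `|L x| <= c * `|x|) ->
  integrable_simple mu D s -> integrable_simple mu D (L \o s).
Proof.
move=> Lc is_; have [ss _] := is_; have sLs := simple_map_comp L ss.
apply/(integrable_simpleP mu mD sLs).
move/(integrable_simpleP mu mD ss): is_ => is_.
have {}Lc x : `|L x| <= `|c| * `|x|.
  by apply: le_trans (Lc x) _; rewrite ler_wpM2r// ler_norm.
apply: (@le_lt_trans _ _ (\int[mu]_(t in D) ((`|c|)%:E * (`|s t|)%:E))%E).
  apply: ge0_le_integral => //; first exact: measurable_norm_simple.
  - exact: (measurable_funeM _ (@measurable_norm_simple s D ss)).
  - by move=> t _; rewrite -EFinM lee_fin; exact: Lc.
rewrite ge0_integralZl//; last exact: measurable_norm_simple.
by apply: lte_mul_pinfty => //; rewrite lee_fin.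
Qed.

Lemma simple_integral_linear (L : {linear X -> X}) (s : S -> X) :
  integrable_simple mu D s ->
  simple_integral mu D (L \o s) = L (simple_integral mu D s).
Proof.
move=> [ss fs]; rewrite simple_integral_comp//; last first.
  move=> x Lx; apply: fs; apply: contraNneq Lx => ->.
  by rewrite linear0.
rewrite /simple_integral !fsbig_finite; try by case: ss.
by rewrite linear_sum; apply: eq_bigr => x _; rewrite linearZ.
Qed.

End SimpleIntegralLaws.

Section SimpleIntegralDomain.
Context {d : measure_display} {S : measurableType d} {R : realType}.
Context {X : completeNormedModType R}.
Variable mu : {measure set S -> \bar R}.

Lemma measureU_null (A B : set S) : measurable A -> measurable B ->
  mu (A `&` B) = 0%E -> (mu (A `|` B) = mu A + mu B)%E.
Proof.
move=> mA mB AB0.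
have -> : A `|` B = A `|` (B `\` A).
  apply/seteqP; split => t [At|Bt]; [by left| |by left|by right; case: Bt].
  by have [At|nAt] := pselect (A t); [left|right].
rewrite measureU//; last 2 first.
- exact: measurableD.
- by rewrite -subset0 => t [At []].
congr (_ + _)%E.
by rewrite [RHS](measureDI mu mB mA) (setIC B) [X in (_ + X)%E]AB0 adde0.
Qed.

Lemma integrable_simpleS (A B : set S) (s : S -> X) :
  measurable A -> measurable B -> A `<=` B ->
  integrable_simple mu B s -> integrable_simple mu A s.
Proof.
move=> mA mB AB [ss fs]; split => // x /fs; apply: le_lt_trans.
have [_ ms] := ss.
apply: le_measure; rewrite ?inE; [exact: measurableI..|].
by apply: setSI.
Qed.

Lemma simple_integralU (A B : set S) (s : S -> X) :
  measurable A -> measurable B -> mu (A `&` B) = 0%E ->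
  integrable_simple mu (A `|` B) s ->
  simple_integral mu (A `|` B) s =
  simple_integral mu A s + simple_integral mu B s.
Proof.
move=> mA mB AB0 is_; have mAB : measurable (A `|` B) by exact: measurableU.
have [ss fs] := is_; have [fr ms] := ss.
have [_ fsA] := integrable_simpleS mA mAB (@subsetUl _ A B) is_.
have [_ fsB] := integrable_simpleS mB mAB (@subsetUr _ A B) is_.
rewrite /simple_integral !fsbig_finite// -big_split/=.
apply: eq_bigr => x _; have [->|x0] := eqVneq x 0.
  by rewrite !scaler0 addr0.
rewrite -scalerDl -fineD; last 2 first.
- by rewrite ge0_fin_numE// fsA.
- by rewrite ge0_fin_numE// fsB.
rewrite setIUl measureU_null//; [exact: measurableI..|].
apply: (@subset_measure0 _ _ _ mu _ (A `&` B)) => //.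
- by apply: measurableI; exact: measurableI.
- exact: measurableI.
- by move=> t [[? _] [? _]].
Qed.

End SimpleIntegralDomain.

(** * Existence and uniqueness of the Bochner integral *)

Lemma cvge0_lt {R : realType} (u : nat -> \bar R) (e : R) :
  u n @[n --> \oo] --> 0%E -> 0 < e -> \forall n \near \oo, (u n < e%:E)%E.
Proof.
by move=> u0 e0; exact: (u0 _ (@nbhs_open_ereal_lt R 0 (fun=> e) e0)).
Qed.

Section LimitsOfSimple.
Context {d : measure_display} {S : measurableType d} {R : realType}.
Context {X : completeNormedModType R}.

Definition limit_of_simple (f : S -> X) : Prop :=
  exists s : nat -> S -> X, (forall n, simple_function (s n)) /\
    forall t, s n t @[n --> \oo] --> f t.

Lemma limit_of_simple_simple (s : S -> X) :
  simple_function s -> limit_of_simple s.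
Proof. by move=> ss; exists (fun=> s); split => // t; exact: cvg_cst. Qed.

Lemma limit_of_simpleB (f g : S -> X) :
  limit_of_simple f -> limit_of_simple g -> limit_of_simple (fun t => f t - g t).
Proof.
move=> [s [ss sf]] [r [sr rg]]; exists (fun n t => s n t - r n t); split.
  by move=> n; exact: (simple_map2 (fun x y => x - y) (ss n) (sr n)).
by move=> t; exact: (cvgB (sf t) (rg t)).
Qed.

Lemma measurable_norm_limit (f : S -> X) (E : set S) :
  limit_of_simple f -> measurable_fun E (fun t => `|f t|).
Proof.
move=> [s [ss sf]].
apply: (@measurable_fun_cvg _ _ _ _ (fun n t => `|s n t|)).
  by move=> n; exact: (simple_map_measurable_fun (fun x => `|x|) (ss n)).
by move=> t _; apply: cvg_norm; exact: sf.
Qed.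

Lemma measurable_enorm_limit (f : S -> X) (E : set S) :
  limit_of_simple f -> measurable_fun E (fun t => (`|f t|)%:E).
Proof. by move=> lf; apply/measurable_EFinP; exact: measurable_norm_limit. Qed.

Lemma limit_of_simple_comp {d' : measure_display} {S' : measurableType d'}
    (phi : S' -> S) (f : S -> X) :
  measurable_fun setT phi -> limit_of_simple f ->
  exists s : nat -> S' -> X, (forall n, simple_function (s n)) /\
    forall t, s n t @[n --> \oo] --> f (phi t).
Proof.
move=> mphi [s [ss sf]]; exists (fun n t => s n (phi t)); split; last first.
  by move=> t; exact: sf.
move=> n; have [fs ms] := ss n; split.
  apply: (@sub_finite_set _ _ (range (s n))) fs.
  by move=> _ [t _ <-]; exists (phi t).
move=> x; rewrite -[X in measurable X]setTI.
by apply: (mphi measurableT ((s n) @^-1` [set x])).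
Qed.

End LimitsOfSimple.

Section BochnerTheory.
Context {d : measure_display} {S : measurableType d} {R : realType}.
Context {X : completeNormedModType R}.
Variable mu : {measure set S -> \bar R}.
Variables (D : set S) (mD : measurable D).
Implicit Types (f : S -> X) (s : nat -> S -> X).

(** Cutting the approximants off where they exceed twice the limit keeps
    pointwise convergence and provides the dominating function [3 |f|]. *)
Lemma L1_approximation_exists f :
  limit_of_simple f -> (\int[mu]_(t in D) (`|f t|)%:E < +oo)%E ->
  exists s, L1_approximation mu D f s.
Proof.
move=> lf intf; have [s [ss sf]] := lf.
(* The factor 2 makes the cut eventually inactive wherever [f t != 0]. *)
pose A n := [set t | `|s n t| <= 2 * `|f t|].
have mA n : measurable (A n).
  have := @measurable_fun_ler _ S R setT (fun t => `|s n t|) (fun t => 2 * `|f t|).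
  move=> /(_ _ _ measurableT [set true]); rewrite setTI.
  rewrite (_ : _ @^-1` _ = A n); last first.
    by apply/seteqP; split => t.
  apply => //.
    exact: (simple_map_measurable_fun (fun x => `|x|) (ss n)).
  by apply: measurable_funM => //; exact: measurable_norm_limit.
pose r n t := if t \in A n then s n t else 0.
have sr n : simple_function (r n) by exact: (simple_map_restrict 0 (mA n) (ss n)).
have rle n t : `|r n t| <= 2 * `|f t|.
  rewrite /r; case: ifPn => [/set_mem//|_].
  by rewrite normr0 mulr_ge0.
have rf t : r n t @[n --> \oo] --> f t.
  have [f0|f0] := eqVneq (f t) 0.
    have -> : r ^~ t = fun=> 0.
      apply/funext => n; apply/eqP; rewrite -normr_le0.
      by apply: le_trans (rle n t) _; rewrite f0 normr0 mulr0.
    by rewrite f0; exact: cvg_cst.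
  apply: cvg_trans (sf t); apply: near_eq_cvg.
  have : `|s n t| @[n --> \oo] --> `|f t| by apply: cvg_norm; exact: sf.
  move/cvgr_le => /(_ (2 * `|f t|)).
  have lt2 : `|f t| < 2 * `|f t| by move: f0; rewrite -normr_gt0; lra.
  move=> /(_ lt2); apply: filterS => n st.
  by rewrite /r ifT//; apply/mem_set.
have dom n t : `|f t - r n t| <= 3 * `|f t|.
  have := ler_normB (f t) (r n t); have := rle n t.
  lra.
have mf3 : measurable_fun D (fun t => (3%:E * (`|f t|)%:E)%E).
  by apply: measurable_funeM; exact: measurable_enorm_limit.
have int3 : mu.-integrable D (fun t => (3%:E * (`|f t|)%:E)%E).
  apply/integrableP; split => //.
  under eq_integral do rewrite gee0_abs ?mule_ge0//.
  rewrite ge0_integralZl//; last exact: measurable_enorm_limit.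
  by apply: lte_mul_pinfty.
have mfr n : measurable_fun D (fun t => (`|f t - r n t|)%:E).
  apply: measurable_enorm_limit; apply: limit_of_simpleB => //.
  exact: limit_of_simple_simple.
exists r; split => [n|].
  apply/(integrable_simpleP mu mD (sr n)).
  apply: le_lt_trans (_ : (\int[mu]_(t in D) (3%:E * (`|f t|)%:E) < _)%E).
    apply: ge0_le_integral => //.
    - exact: (measurable_norm_simple (sr n)).
    - move=> t _; rewrite -EFinM lee_fin; apply: le_trans (rle n t) _.
      by rewrite ler_wpM2r// ler_nat.
  rewrite ge0_integralZl//; last exact: measurable_enorm_limit.
  by apply: lte_mul_pinfty.
have := @dominated_cvg _ _ _ mu D mD (fun n t => (`|f t - r n t|)%:E) (cst 0%E)
  (fun t => (3%:E * (`|f t|)%:E)%E).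
rewrite integral0; apply => //.
- move=> t _; apply/cvg_EFin; first by near=> n.
  rewrite /=.
  have /cvg_norm : f t - r n t @[n --> \oo] --> f t - f t.
    exact: (cvgB (cvg_cst _) (rf t)).
  by rewrite subrr normr0.
- by move=> n t _; rewrite gee0_abs// -EFinM lee_fin.
Unshelve. all: by end_near.
Qed.

(** Two step functions approximating the same [f] have close integrals; this
    yields existence and uniqueness of the limit. *)
Lemma norm_simple_integralB f (s r : S -> X) : limit_of_simple f ->
  integrable_simple mu D s -> integrable_simple mu D r ->
  ((`|simple_integral mu D s - simple_integral mu D r|)%:E <=
    \int[mu]_(t in D) (`|f t - s t|)%:E + \int[mu]_(t in D) (`|f t - r t|)%:E)%E.
Proof.
move=> lf is_ ir; rewrite -simple_integralB//.
apply: le_trans (norm_simple_integral mD (integrable_simpleB mD is_ ir)) _.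
have ls := limit_of_simple_simple (integrable_simple_function is_).
have lr := limit_of_simple_simple (integrable_simple_function ir).
have ms := @measurable_enorm_limit _ _ _ _ _ D (limit_of_simpleB lf ls).
have mr := @measurable_enorm_limit _ _ _ _ _ D (limit_of_simpleB lf lr).
rewrite -ge0_integralD//; apply: ge0_le_integral => //.
- exact: measurable_enorm_limit (limit_of_simpleB ls lr).
- by apply: emeasurable_funD.
- move=> t _; rewrite -EFinD lee_fin.
  have -> : s t - r t = (f t - r t) - (f t - s t).
    by rewrite opprB [RHS]addrC addrA subrK.
  by apply: le_trans (ler_normB _ _) _; rewrite addrC.
Qed.

Lemma simple_integral_cvg f s : limit_of_simple f ->
  L1_approximation mu D f s -> cvgn (fun n => simple_integral mu D (s n)).
Proof.
move=> lf [is_ sf]; apply/cauchy_cvgP/cauchy_exP => e e0.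
have e2 : 0 < e / 2 by rewrite divr_gt0.
have [N _ NP] := cvge0_lt sf e2.
exists (simple_integral mu D (s N)); exists N => // n /= Nn.
rewrite -ball_normE/= -lte_fin.
apply: le_lt_trans (norm_simple_integralB lf (is_ N) (is_ n)) _.
by rewrite [e]splitr EFinD; apply: lteD; [exact: (NP N (leqnn N))|exact: (NP n Nn)].
Qed.

Lemma simple_integral_lim_unique f s r (v w : X) : limit_of_simple f ->
  L1_approximation mu D f s -> L1_approximation mu D f r ->
  simple_integral mu D (s n) @[n --> \oo] --> v ->
  simple_integral mu D (r n) @[n --> \oo] --> w -> v = w.
Proof.
move=> lf [is_ sf] [ir rf] sv rw; apply/eqP; rewrite -subr_eq0 -normr_le0.
have svw : `|simple_integral mu D (s n) - simple_integral mu D (r n)| @[n --> \oo]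
    --> `|v - w| by apply: cvg_norm; exact: cvgB.
apply/ler_addgt0Pr => e e0; rewrite add0r; apply: (cvgr_to_le svw).
have e2 : 0 < e / 2 by rewrite divr_gt0.
near=> n; apply: ltW; rewrite -lte_fin.
apply: le_lt_trans (norm_simple_integralB lf (is_ n) (ir n)) _.
rewrite [e]splitr EFinD; apply: lteD; near: n; exact: cvge0_lt.
Unshelve. all: by end_near.
Qed.

End BochnerTheory.

(** * Almost everywhere equal integrands *)

Section AeInvariance.
Context {d : measure_display} {S : measurableType d} {R : realType}.
Context {X : completeNormedModType R}.
Variable mu : {measure set S -> \bar R}.
Implicit Types (D : set S).

Import HBNNSimple.

(** The integral of an arbitrary nonnegative function is a supremum over the
    measurable step functions below it, and these can be set to zero on the
    exceptional null set without changing their integrals. *)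
Lemma ge0_le_integral_ae D (f g : S -> \bar R) :
  (forall t, D t -> 0 <= f t)%E -> (forall t, D t -> 0 <= g t)%E ->
  {ae mu, forall t, D t -> f t = g t} ->
  (\int[mu]_(t in D) f t <= \int[mu]_(t in D) g t)%E.
Proof.
move=> f0 g0 [N [mN N0 sub]].
rewrite ge0_integralE// [leRHS]ge0_integralE//.
apply: ge_ereal_sup => _ [h /= hf <-].
have [h' [hh' h'0]] : exists h' : {nnsfun S >-> R},
    (forall t, ~ N t -> h' t = h t) /\ (forall t, N t -> h' t = 0).
  exists (proj_nnsfun h (measurableC mN)); split => t Nt; rewrite -mrestrict patchE.
    by rewrite ifT//; apply/mem_set.
  by rewrite ifF//; apply/memNset.
have -> : sintegral mu h = sintegral mu h'.
  rewrite -!integralT_nnsfun; apply: ge0_ae_eq_integral => //.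
  - exact/measurable_EFinP.
  - exact/measurable_EFinP.
  - by move=> t _; rewrite lee_fin.
  - by move=> t _; rewrite lee_fin.
  exists N; split => // t /= hh; apply: contrapT => /hh' E; apply: hh => _.
  by congr EFin; exact/esym.
apply: ereal_sup_ubound; exists h' => //= t.
have [Nt|Nt] := pselect (N t).
  by rewrite h'0//; apply: erestrict_ge0.
rewrite hh'//; apply: le_trans (hf t) _; rewrite !patchE.
case: ifPn => // /set_mem Dt; suff -> : f t = g t by [].
by apply: contrapT => fg; apply: Nt; apply: sub => /= /(_ Dt).
Qed.

Lemma ge0_eq_integral_ae D (f g : S -> \bar R) :
  (forall t, D t -> 0 <= f t)%E -> (forall t, D t -> 0 <= g t)%E ->
  {ae mu, forall t, D t -> f t = g t} ->
  (\int[mu]_(t in D) f t = \int[mu]_(t in D) g t)%E.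
Proof.
move=> f0 g0 fg; apply/eqP; rewrite eq_le !ge0_le_integral_ae//.
by apply: filterS fg => t fg Dt; rewrite fg.
Qed.

Lemma L1_approximation_ae D (f g : S -> X) s :
  {ae mu, forall t, D t -> f t = g t} ->
  L1_approximation mu D f s -> L1_approximation mu D g s.
Proof.
move=> fg [is_ sf]; split => //; apply: cvg_trans sf.
apply: near_eq_cvg; apply: nearW => n; apply: ge0_eq_integral_ae => //.
by apply: filterS fg => t fg Dt; rewrite fg.
Qed.

Lemma strongly_measurable_ae D (f g : S -> X) :
  {ae mu, forall t, D t -> f t = g t} ->
  strongly_measurable mu D f -> strongly_measurable mu D g.
Proof.
move=> fg [s [ss sf]]; exists s; split => //; apply: filterS2 fg sf.
by move=> t fg sf Dt; rewrite -fg//; exact: sf.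
Qed.

Lemma bochner_integrable_ae D (f g : S -> X) :
  {ae mu, forall t, D t -> f t = g t} ->
  bochner_integrable mu D f -> bochner_integrable mu D g.
Proof.
move=> fg [sf [s sL1]]; split; first exact: strongly_measurable_ae sf.
by exists s; exact: L1_approximation_ae sL1.
Qed.

Lemma bochner_integral_ae D (f g : S -> X) :
  {ae mu, forall t, D t -> f t = g t} ->
  bochner_integral mu D f = bochner_integral mu D g.
Proof.
move=> fg; have gf : {ae mu, forall t, D t -> g t = f t}.
  by apply: filterS fg => t fg Dt; rewrite fg.
congr (xget 0 _); apply/seteqP; split => v [s [sL1 sv]]; exists s;
  split => //; exact: L1_approximation_ae sL1.
Qed.

(** An almost everywhere limit of step functions is almost everywhere equal
    to an everywhere limit, obtained by killing the null set. *)
Lemma strongly_measurable_limit (f : S -> X) :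
  strongly_measurable mu setT f ->
  exists2 g, limit_of_simple g & {ae mu, forall t, f t = g t}.
Proof.
move=> [s [ss [N [mN N0 sub]]]].
exists (fun t => if t \in ~` N then f t else 0); last first.
  exists N; split => // t /= fNt; apply: contrapT => Nt; apply: fNt.
  by rewrite ifT//; apply/mem_set.
exists (fun n t => if t \in ~` N then s n t else 0); split.
  by move=> n; exact: (simple_map_restrict 0 (measurableC mN) (ss n)).
move=> t; case: ifPn => [/set_mem Nt|_]; last exact: cvg_cst.
by apply: contrapT => st; apply: Nt; apply: sub => /= /(_ I).
Qed.

End AeInvariance.

(** * Laws of the Bochner integral *)

(** The relational form lets the laws below be proved by transporting
    approximating sequences, without reference to the chosen value. *)
Definition is_bochner_integral {d : measure_display} {S : measurableType d}
    {R : realType} {X : completeNormedModType R}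
    (mu : {measure set S -> \bar R}) (D : set S) (f : S -> X) (v : X) : Prop :=
  exists s, L1_approximation mu D f s /\
    simple_integral mu D (s n) @[n --> \oo] --> v.

Section BochnerLaws.
Context {d : measure_display} {S : measurableType d} {R : realType}.
Context {X : completeNormedModType R}.
Variable mu : {measure set S -> \bar R}.
Implicit Types (f g : S -> X) (s : nat -> S -> X) (D : set S).

Lemma bochner_integralP D f : measurable D -> limit_of_simple f ->
  (\int[mu]_(t in D) (`|f t|)%:E < +oo)%E ->
  is_bochner_integral mu D f (bochner_integral mu D f).
Proof.
move=> mD lf intf; have [s sL1] := L1_approximation_exists mD lf intf.
have cs := simple_integral_cvg mD lf sL1.
rewrite /bochner_integral; case: xgetP => [v _ //|/(_ (lim (simple_integral mu D (s n) @[n --> \oo])))].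
by move=> []; exists s.
Qed.

Lemma bochner_integral_unique D f v : measurable D -> limit_of_simple f ->
  is_bochner_integral mu D f v -> bochner_integral mu D f = v.
Proof.
move=> mD lf fv; apply: xget_unique => // w [r [rL1 rw]].
have [s [sL1 sv]] := fv.
exact: (simple_integral_lim_unique mD lf rL1 sL1 rw sv).
Qed.

Lemma limit_bochner_integrable D f : measurable D -> limit_of_simple f ->
  (\int[mu]_(t in D) (`|f t|)%:E < +oo)%E -> bochner_integrable mu D f.
Proof.
move=> mD lf intf; split; last exact: L1_approximation_exists.
have [s [ss sf]] := lf; exists s; split => //.
by apply: aeW => t _; exact: sf.
Qed.

Lemma measurable_enormB D f (s : S -> X) : limit_of_simple f ->
  simple_function s -> measurable_fun D (fun t => (`|f t - s t|)%:E).
Proof.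
move=> lf ss; apply: measurable_enorm_limit; apply: limit_of_simpleB => //.
exact: limit_of_simple_simple.
Qed.

Lemma norm_is_bochner_integral D f v : measurable D -> limit_of_simple f ->
  is_bochner_integral mu D f v -> ((`|v|)%:E <= \int[mu]_(t in D) (`|f t|)%:E)%E.
Proof.
move=> mD lf [s [[is_ sf] sv]].
have ss n := integrable_simple_function (is_ n).
apply/lee_addgt0Pr => e e0.
have [->|] := eqVneq (\int[mu]_(t in D) (`|f t|)%:E)%E +oo%E; first by rewrite leey.
rewrite -ltey -ge0_fin_numE ?integral_ge0// => finf.
rewrite -(fineK finf) -EFinD lee_fin.
apply: (cvgr_to_le (cvg_norm sv)).
near=> n; rewrite -lee_fin EFinD (fineK finf).
apply: le_trans (norm_simple_integral mD (is_ n)) _.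
apply: (@le_trans _ _ (\int[mu]_(t in D) (`|f t|)%:E +
                       \int[mu]_(t in D) (`|f t - s n t|)%:E)%E).
  rewrite -ge0_integralD//; last 2 first.
  - exact: measurable_enorm_limit.
  - exact: measurable_enormB.
  apply: ge0_le_integral => //.
  - exact: (measurable_norm_simple (ss n)).
  - by apply: emeasurable_funD; [exact: measurable_enorm_limit|exact: measurable_enormB].
  - move=> t _; rewrite -EFinD lee_fin -{1}(subKr (f t) (s n t)).
    exact: ler_normB.
apply: leeD => //; apply: ltW; near: n; exact: cvge0_lt.
Unshelve. all: by end_near.
Qed.

Lemma is_bochner_integralB D f g v w : measurable D ->
  limit_of_simple f -> limit_of_simple g ->
  is_bochner_integral mu D f v -> is_bochner_integral mu D g w ->
  is_bochner_integral mu D (fun t => f t - g t) (v - w).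
Proof.
move=> mD lf lg [s [[is_ sf] sv]] [r [[ir rg] rw]].
exists (fun n t => s n t - r n t); split; last first.
  under eq_cvg do rewrite simple_integralB//.
  exact: cvgB.
split=> [n|]; first exact: integrable_simpleB.
have ss n := integrable_simple_function (is_ n).
have sr n := integrable_simple_function (ir n).
apply: (@squeeze_cvge _ _ _ _ (fun=> 0%E) _ (fun n =>
   \int[mu]_(t in D) (`|f t - s n t|)%:E + \int[mu]_(t in D) (`|g t - r n t|)%:E)%E).
- apply: nearW => n; rewrite integral_ge0//=.
  rewrite -ge0_integralD//; last 2 first.
  - exact: measurable_enormB.
  - exact: measurable_enormB.
  apply: ge0_le_integral => //.
  - apply: measurable_enormB; first exact: limit_of_simpleB.
    exact: (simple_map2 (fun x y => x - y) (ss n) (sr n)).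
  - by apply: emeasurable_funD; exact: measurable_enormB.
  - move=> t _; rewrite -EFinD lee_fin.
    by rewrite opprD addrACA -opprD; exact: ler_normB.
- exact: cvg_cst.
- by rewrite -[X in _ --> X]adde0; apply: cvgeD.
Qed.

Lemma is_bochner_integral_linear D f v (L : {linear X -> X}) (c : R) :
  measurable D -> limit_of_simple f -> continuous L ->
  (forall x, `|L x| <= c * `|x|) ->
  is_bochner_integral mu D f v -> is_bochner_integral mu D (L \o f) (L v).
Proof.
move=> mD lf cL Lc [s [[is_ sf] sv]].
have ss n := integrable_simple_function (is_ n).
exists (fun n => L \o s n); split; last first.
  under eq_cvg do rewrite simple_integral_linear//.
  by apply: (cvg_comp _ _ sv); exact: cL.
split=> [n|]; first exact: (integrable_simple_bounded mD Lc).
have lLf : limit_of_simple (L \o f).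
  have [r [sr rf]] := lf; exists (fun n => L \o r n); split.
    by move=> n; exact: (simple_map_comp L (sr n)).
  by move=> t; apply: (cvg_comp _ _ (rf t)); exact: cL.
apply: (@squeeze_cvge _ _ _ _ (fun=> 0%E) _ (fun n =>
   (`|c|)%:E * \int[mu]_(t in D) (`|f t - s n t|)%:E)%E).
- apply: nearW => n; rewrite integral_ge0//=.
  rewrite -ge0_integralZl//; last exact: measurable_enormB.
  apply: ge0_le_integral => //.
  - apply: measurable_enormB => //; exact: (simple_map_comp L (ss n)).
  - by apply: measurable_funeM; exact: measurable_enormB.
  - move=> t _; rewrite -EFinM lee_fin/= -linearB; apply: le_trans (Lc _) _.
    by rewrite ler_wpM2r// ler_norm.
- exact: cvg_cst.
- by rewrite -(mule0 (`|c|)%:E); apply: cvgeZl.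
Qed.

Lemma bochner_integralU (A B : set S) f :
  measurable A -> measurable B -> mu (A `&` B) = 0%E -> limit_of_simple f ->
  (\int[mu]_(t in A `|` B) (`|f t|)%:E < +oo)%E ->
  bochner_integral mu (A `|` B) f =
  bochner_integral mu A f + bochner_integral mu B f.
Proof.
move=> mA mB AB0 lf intf; have mAB : measurable (A `|` B) by exact: measurableU.
have [s [is_ sf]] := L1_approximation_exists mAB lf intf.
have sub C : measurable C -> C `<=` A `|` B -> L1_approximation mu C f s.
  move=> mC CAB; split=> [n|]; first exact: (integrable_simpleS mC mAB CAB).
  apply: (squeeze_cvge _ (cvg_cst 0%E) sf); apply: nearW => n.
  rewrite integral_ge0//=; apply: ge0_subset_integral => //.
  by apply: measurable_enormB => //; exact: integrable_simple_function (is_ n).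
have fin C : measurable C -> C `<=` A `|` B ->
    simple_integral mu C (s n) @[n --> \oo] --> bochner_integral mu C f.
  move=> mC CAB; have sC := sub _ mC CAB.
  rewrite (bochner_integral_unique (v := lim (simple_integral mu C (s n) @[n --> \oo])))//.
    exact: simple_integral_cvg sC.
  by exists s; split => //; exact: simple_integral_cvg sC.
have cs : simple_integral mu (A `|` B) (s n) @[n --> \oo] -->
    bochner_integral mu A f + bochner_integral mu B f.
  under eq_cvg do rewrite simple_integralU//.
  by apply: cvgD; apply: fin.
have cAB := fin _ mAB (@subset_refl _ _).
exact: (cvg_unique _ cAB cs).
Qed.

(** A surjection that transports the measure transports step functions with
    all their values, hence every approximating sequence. *)
Lemma is_bochner_integral_comp {d' : measure_display} {S' : measurableType d'}
    (nu : {measure set S' -> \bar R}) (phi : S' -> S) D f v :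
  measurable_fun setT phi -> range phi = setT ->
  (forall A, measurable A -> nu (phi @^-1` A) = mu A) ->
  measurable D -> limit_of_simple f ->
  is_bochner_integral mu D f v ->
  is_bochner_integral nu (phi @^-1` D) (f \o phi) v.
Proof.
move=> mphi sphi nuphi mD lf [s [[is_ sf] sv]].
have ss n := integrable_simple_function (is_ n).
have Dphi A : phi @^-1` D `&` phi @^-1` A = phi @^-1` (D `&` A) by [].
exists (fun n => s n \o phi); split; last first.
  apply: cvg_trans sv; apply: near_eq_cvg; apply: nearW => n.
  rewrite /simple_integral; have -> : range (s n \o phi) = range (s n).
    by rewrite -(image_comp phi) sphi.
  apply: eq_fsbigr => x _; rewrite comp_preimage Dphi nuphi//.
  by apply: measurableI => //; case: (ss n).
split=> [n|].
  have [[fs ms] fin] := is_ n; split.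
    split; first by rewrite -(image_comp phi) sphi.
    by move=> x; rewrite comp_preimage -[X in measurable X]setTI; exact: mphi.
  by move=> x /fin; rewrite comp_preimage Dphi nuphi//; exact: measurableI.
apply: cvg_trans sf; apply: near_eq_cvg; apply: nearW => n.
rewrite -(@ge0_integral_pushforward _ _ _ _ _ phi mphi nu D (fun t => (`|f t - s n t|)%:E))//.
  by apply: eq_measure_integral => A mA AD; rewrite -nuphi.
exact: measurable_enormB.
Qed.

End BochnerLaws.

(** * Translations of the line *)

Section Translation.
Context {R : realType}.
Implicit Types (c : R) (A : set R).

Local Notation mu := (@lebesgue_measure R).

Definition translate (c : R) : measurableTypeR R -> measurableTypeR R :=
  fun s => s + c.

Lemma measurable_translate c : measurable_fun setT (translate c).
Proof. exact: measurable_funD. Qed.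

HB.instance Definition _ c :=
  isMeasurableFun.Build _ _ _ _ (translate c) (measurable_translate c).

Lemma range_translate c : range (translate c) = setT.
Proof. by apply/seteqP; split => // s _; exists (s - c); rewrite // /translate subrK. Qed.

Lemma preimage_translate_itv c (b1 b2 : bool) (x y : R) :
  translate c @^-1` [set` Interval (BSide b1 (x + c)) (BSide b2 (y + c))] =
  [set` Interval (BSide b1 x) (BSide b2 y)].
Proof.
by case: b1; case: b2; apply/seteqP; split => s;
  rewrite /= /translate !in_itv/= ?lerD2r ?ltrD2r.
Qed.

(** The two measures agree on bounded half-open intervals, which determine
    them. *)
Lemma lebesgue_measure_translate c A : measurable A ->
  mu (translate c @^-1` A) = mu A.
Proof.
move=> mA.
rewrite -[LHS]/(pushforward mu (translate c) A).
apply/esym/lebesgue_measure_unique => // _ [[a b]] _ <-.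
have E := preimage_translate_itv c false false (a - c) (b - c).
rewrite !subrK in E.
transitivity (mu `]a - c, b - c]%classic); last exact: (congr1 mu (esym E)).
rewrite !lebesgue_measure_itv/= !lte_fin ltrD2r.
by case: ifP => // _; congr EFin; rewrite opprB addrA subrK.
Qed.

Lemma ge0_integral_translate c (D : set R) (f : R -> \bar R) :
  measurable D -> measurable_fun D f -> (forall s, 0 <= f s)%E ->
  (\int[mu]_(s in D) f s = \int[mu]_(s in translate c @^-1` D) f (s + c)%R)%E.
Proof.
move=> mD mf f0.
rewrite -(@ge0_integral_pushforward _ _ _ _ _ _ (measurable_translate c) mu D f)//.
  apply: eq_measure_integral => A mA AD.
  exact/esym/lebesgue_measure_translate.
Qed.

Lemma ae_translate c (P : R -> Prop) :
  {ae mu, forall s, P s} -> {ae mu, forall s, P (s + c)}.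
Proof.
move=> [N [mN N0 sub]]; exists (translate c @^-1` N); split.
- by rewrite -[X in measurable X]setTI; exact: measurable_translate.
- by rewrite lebesgue_measure_translate.
- by move=> s /= Ps; exact: sub.
Qed.

End Translation.

(** * Discretisation of the line *)

Section Grid.
Context {R : realType}.

(** The truncation to [[-n, n]] makes the range finite; adding 1 to the floor
    puts the value strictly above an argument of that interval. *)
Definition grid (n : nat) (s : R) : R :=
  ((Num.floor (n.+1%:R * Num.max (- n%:R) (Num.min s n%:R)))%:~R + 1) / n.+1%:R.

(** Step functions that converge to the identity strictly from above, so that
    right-continuity is enough to pass to the limit along them. *)
Lemma simple_map_grid n : simple_map (grid n : measurableTypeR R -> R).
Proof.
have mono : {homo grid n : x y / x <= y}.
  move=> x y xy; rewrite /grid ler_wpM2r ?invr_ge0// lerD2r ler_int.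
  apply: le_floor; rewrite ler_wpM2l// /Num.max /Num.min.
  by repeat case: ifPn; rewrite -?leNgt; lra.
split; last first.
  move=> y; rewrite -[X in measurable X]setTI.
  by apply: (nondecreasing_measurable measurableT mono).
pose N := (n.+1 * n)%N.
apply: (@sub_finite_set _ _ ((fun k : nat => ((k%:Z - N%:Z)%:~R + 1) / n.+1%:R) @` `I_(N + N).+1)); last first.
  by apply: finite_image; exact: finite_II.
move=> _ [s _ <-]; rewrite /grid.
set x := Num.max _ _; set z := Num.floor _.
have xn : - n%:R <= x <= n%:R.
  rewrite /x /Num.max /Num.min; have := ler0n R n.
  by repeat case: ifPn; rewrite -?leNgt; lra.
have z1 : - N%:Z <= z.
  rewrite floor_ge_int mulrNz -pmulrn natrM -mulrN ler_wpM2l//.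
  by case/andP: xn.
have z2 : z <= N%:Z.
  rewrite -(ler_int R); apply: le_trans (floor_le _) _.
  by rewrite -pmulrn natrM ler_wpM2l//; case/andP: xn.
exists (absz (z + N%:Z)); first by rewrite /=; lia.
by rewrite gez0_abs ?addrK//; lia.
Qed.

Lemma grid_bounds n s : `|s| <= n%:R -> s < grid n s <= s + n.+1%:R^-1.
Proof.
rewrite ler_norml => /andP[s1 s2]; rewrite /grid min_l// max_r//.
have n0 : 0 < n.+1%:R :> R by [].
have := floor_itv (n.+1%:R * s); rewrite intrD => /andP[f1 f2].
rewrite ltr_pdivlMr// mulrC f2/= ler_pdivrMr// mulrDl mulVf ?gt_eqF//.
by rewrite lerD2r [_ * n.+1%:R]mulrC.
Qed.

Lemma near_grid_bounds (s : R) :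
  \forall n \near \oo, s < grid n s <= s + n.+1%:R^-1.
Proof.
have := nbhs_infty_ger `|s|.
by apply: filterS => n; exact: grid_bounds.
Qed.

Lemma cvg_grid (s : R) : grid n s @[n --> \oo] --> s.
Proof.
apply: (@squeeze_cvgr _ _ _ _ (fun=> s) (fun n => s + n.+1%:R^-1)).
- by have := near_grid_bounds s; apply: filterS => n /andP[/ltW -> ->].
- exact: cvg_cst.
- rewrite -[X in _ --> X]addr0; apply: cvgD; first exact: cvg_cst.
  exact: cvg_harmonic.
Qed.

End Grid.

(** * Jensen's inequality for powers *)

Section Jensen.
Context {R : realType}.

Lemma powR_predr (a p : R) : 0 < a -> a `^ p = a `^ (p - 1) * a.
Proof.
move=> a0; rewrite -[X in _ * X](powRr1 (ltW a0)) -powRD ?subrK//.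
by rewrite (gt_eqF a0) implybT.
Qed.

(** Tangent line of the convex function [h ^ p] at [a]. After rescaling it is
    Bernoulli's inequality [1 + p (x - 1) <= x ^ p], which follows from
    [1 - 1 / x <= ln x] applied to [x ^ p = x exp ((p - 1) ln x)]. *)
Lemma powR_tangent (p a h : R) : 1 <= p -> 0 < a -> 0 <= h ->
  p * a `^ (p - 1) * h <= h `^ p + (p - 1) * a `^ p.
Proof.
move=> p1 a0 h0.
have ap := powR_predr p a0.
have [->|hn0] := eqVneq h 0.
  by rewrite mulr0 addr_ge0 ?powR_ge0// mulr_ge0 ?powR_ge0// subr_ge0.
have {hn0}h0 : 0 < h by rewrite lt_neqAle eq_sym hn0.
have hp : h `^ p = a `^ p * (h / a) `^ p.
  rewrite -powRM ?(ltW a0) ?divr_ge0 ?(ltW h0)//; last exact: ltW.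
  by rewrite mulrCA mulfV ?gt_eqF// mulr1.
set x := h / a in hp; have x0 : 0 < x by rewrite divr_gt0.
have bern : 1 + p * (x - 1) <= x `^ p.
  have xp : x `^ p = x * x `^ (p - 1) by rewrite (powR_predr p x0) mulrC.
  have lnx : 1 - x^-1 <= ln x.
    have := expR_ge1Dx (- ln x); rewrite expRN lnK ?posrE//; lra.
  have e1 : 1 + (p - 1) * (1 - x^-1) <= x `^ (p - 1).
    rewrite /powR gt_eqF//; apply: le_trans (expR_ge1Dx _).
    by rewrite lerD2l ler_wpM2l// subr_ge0.
  rewrite xp; apply: le_trans (ler_wpM2l (ltW x0) e1).
  by rewrite le_eqVlt; apply/orP; left; apply/eqP; field; rewrite gt_eqF.
have hE : h = a * x by rewrite /x mulrCA mulfV ?gt_eqF// mulr1.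
have ap0 : 0 <= a `^ p := powR_ge0 _ _.
have := ler_wpM2l ap0 bern; rewrite hp.
have -> : p * a `^ (p - 1) * h = p * a `^ p * x by rewrite hE ap; ring.
lra.
Qed.

Local Open Scope ereal_scope.

(** Obtained by integrating against [w] the tangent inequality at [a = A / W],
    the weighted mean of [h] when [W] is the mass of the weight. *)
Lemma weighted_jensen {d : measure_display} {S : measurableType d}
    (mu : {measure set S -> \bar R}) (D : set S) (w h : S -> R) (p W A : R) :
  measurable D -> measurable_fun D w -> measurable_fun D h ->
  (forall t, 0 <= w t)%R -> (forall t, 0 <= h t)%R -> (1 <= p)%R -> (0 < W)%R ->
  \int[mu]_(t in D) (w t)%:E <= W%:E ->
  \int[mu]_(t in D) (w t * h t)%:E = A%:E ->
  (A `^ p)%:E <= (W `^ (p - 1))%:E * \int[mu]_(t in D) (w t * h t `^ p)%:E.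
Proof.
move=> mD mw mh w0 h0 p1 W0 intw inth.
have mhp : measurable_fun D (fun t => h t `^ p)%R.
  exact: (measurableT_comp (measurable_powR p) mh).
have A0 : (0 <= A)%R.
  by rewrite -lee_fin -inth integral_ge0// => t _; rewrite lee_fin mulr_ge0.
have [A00|An0] := eqVneq A 0%R.
  rewrite A00 powR0 ?gt_eqF// ?(lt_le_trans ltr01)//.
  by rewrite mule_ge0 ?lee_fin ?powR_ge0// integral_ge0// => t _; rewrite lee_fin mulr_ge0 ?powR_ge0.
have {}A0 : (0 < A)%R by rewrite lt_neqAle eq_sym An0.
pose a := (A / W)%R; have a0 : (0 < a)%R by rewrite divr_gt0.
set I := \int[mu]_(t in D) _.
have I0 : 0 <= I by apply: integral_ge0 => t _; rewrite lee_fin mulr_ge0 ?powR_ge0.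
have mwE : measurable_fun D (fun t => (w t)%:E) by exact/measurable_EFinP.
have mwhE : measurable_fun D (fun t => (w t * h t)%:E).
  by apply/measurable_EFinP; exact: measurable_funM.
have mwhpE : measurable_fun D (fun t => (w t * h t `^ p)%:E).
  by apply/measurable_EFinP; exact: measurable_funM.
have wE t : D t -> 0 <= (w t)%:E by rewrite lee_fin.
have whE t : D t -> 0 <= (w t * h t)%:E by rewrite lee_fin mulr_ge0.
have whpE t : D t -> 0 <= (w t * h t `^ p)%:E.
  by rewrite lee_fin mulr_ge0 ?powR_ge0.
have c1 : 0 <= (p * a `^ (p - 1))%:E.
  by rewrite lee_fin mulr_ge0 ?powR_ge0// (le_trans ler01).
have c2 : 0 <= ((p - 1) * a `^ p)%:E.
  by rewrite lee_fin mulr_ge0 ?powR_ge0// subr_ge0.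
have key : (p * a `^ (p - 1) * A)%:E <= I + ((p - 1) * a `^ p * W)%:E.
  apply: (@le_trans _ _ (I + ((p - 1) * a `^ p)%:E * \int[mu]_(t in D) (w t)%:E)); last first.
    by apply: leeD2l; rewrite [leRHS]EFinM; exact: lee_wpmul2l.
  rewrite EFinM -inth.
  rewrite -(ge0_integralZl mu mD mwhE whE c1) -(ge0_integralZl mu mD mwE wE c2).
  have m2 := measurable_funeM ((p - 1) * a `^ p)%:E mwE.
  rewrite -ge0_integralD//; last by move=> t Dt; rewrite mule_ge0 ?wE.
  apply: ge0_le_integral => //.
  - by move=> t Dt; rewrite mule_ge0 ?whE.
  - exact: measurable_funeM.
  - exact: emeasurable_funD.
  - move=> t _; rewrite -!EFinM -EFinD lee_fin.
    have := ler_wpM2l (w0 t) (powR_tangent p1 a0 (h0 t)).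
    by rewrite mulrDr [(w t * (_ * h t))%R]mulrCA [(w t * (_ * a `^ p))%R]mulrC.
have aW : (a * W = A)%R by rewrite /a divfK// gt_eqF.
have AWp : (A `^ p = W `^ (p - 1) * (a `^ p * W))%R.
  by rewrite -aW powRM ?(ltW a0) ?(ltW W0)// (powR_predr p W0) mulrCA.
rewrite AWp EFinM lee_wpmul2l ?lee_fin ?powR_ge0//.
have ap : (a `^ (p - 1) * A = a `^ p * W)%R.
  by rewrite -aW mulrA -powR_predr.
move: key I0; case: I => [I key _|_ _|//]; last by rewrite leey.
rewrite lee_fin; move: key; rewrite -EFinD lee_fin -mulrA ap; lra.
Qed.

End Jensen.

(** * Convolution with an exponential weight *)

Section RestrictedTonelli.
Context {R : realType}.
Local Notation mu := (@lebesgue_measure R).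
Variables (G : measurableTypeR R * measurableTypeR R -> \bar R).
Hypothesis mG : measurable_fun setT G.
Hypothesis G0 : forall z, (0 <= G z)%E.
Variables (I J : set (measurableTypeR R)) (mI : measurable I) (mJ : measurable J).

Let F : measurableTypeR R * measurableTypeR R -> \bar R := G \_ (I `*` J).

Let mF : measurable_fun setT F.
Proof.
apply/(measurable_restrictT G (measurableX mI mJ)).
exact: measurable_funTS.
Qed.

Let F0 z : (0 <= F z)%E.
Proof. exact: erestrict_ge0. Qed.

(** Tonelli's theorem for the function cut off outside the rectangle. *)
Lemma ge0_restricted_tonelli :
  (\int[mu]_(t in I) \int[mu]_(r in J) G (t, r) =
   \int[mu]_(r in J) \int[mu]_(t in I) G (t, r))%E.
Proof.
have E1 t : (\int[mu]_r F (t, r) = ((fun t => \int[mu]_(r in J) G (t, r)) \_ I) t)%E.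
  rewrite patchE; case: ifPn => tI.
    rewrite [RHS]integral_mkcond; apply: eq_integral => r _.
    by rewrite /F !patchE in_setX tI.
  by rewrite integral0_eq// => r _; rewrite /F patchE in_setX (negbTE tI).
have E2 r : (\int[mu]_t F (t, r) = ((fun r => \int[mu]_(t in I) G (t, r)) \_ J) r)%E.
  rewrite patchE; case: ifPn => rJ.
    rewrite [RHS]integral_mkcond; apply: eq_integral => t _.
    by rewrite /F !patchE in_setX rJ andbT.
  by rewrite integral0_eq// => t _; rewrite /F patchE in_setX (negbTE rJ) andbF.
rewrite integral_mkcond [RHS]integral_mkcond.
under eq_integral do rewrite -E1; under [RHS]eq_integral do rewrite -E2.
exact: (fubini_tonelli F mF F0).
Qed.

End RestrictedTonelli.

Lemma measurable_integral_slice {R : realType}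
    (G : measurableTypeR R * measurableTypeR R -> \bar R)
    (J : set (measurableTypeR R)) :
  measurable_fun setT G -> (forall z, (0 <= G z)%E) -> measurable J ->
  measurable_fun setT (fun t => \int[@lebesgue_measure R]_(r in J) G (t, r))%E.
Proof.
move=> mG G0 mJ.
have := @measurable_fun_fubini_tonelli_F _ _ _ _ R (@lebesgue_measure R)
  (G \_ (setT `*` J)).
rewrite (_ : fubini_F _ _ = fun t => \int[@lebesgue_measure R]_(r in J) G (t, r))%E.
  apply.
    apply/(measurable_restrictT G (measurableX measurableT mJ)).
    exact: measurable_funTS.
  by move=> z; exact: erestrict_ge0.
apply/funext => t; rewrite /fubini_F [RHS]integral_mkcond.
by apply: eq_integral => r _; rewrite !patchE in_setX in_setT.
Qed.

Section ExponentialWeight.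
Context {R : realType}.
Local Notation mu := (@lebesgue_measure R).
Variables (delta M : R) (delta_gt0 : 0 < delta) (M_ge1 : 1 <= M).

Definition exp_weight (t s : R) : R := M * expR (- delta * (t - s)).

Lemma exp_weight_ge0 t s : 0 <= exp_weight t s.
Proof. by rewrite mulr_ge0 ?expR_ge0// (le_trans ler01). Qed.

Lemma exp_weight_translate t r : exp_weight t (r + t) = exp_weight 0 r.
Proof. by rewrite /exp_weight; congr (_ * expR (_ * _)); ring. Qed.

Lemma measurable_exp_weight t (D : set R) : measurable_fun D (exp_weight t).
Proof.
apply: measurable_funTS; apply: measurable_funM => //.
have m : measurable_fun setT (fun s : R => - delta * (t - s)).
  by apply: measurable_funM => //; exact: measurable_funB.
exact: (measurableT_comp (@measurable_expR R) m).
Qed.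

Lemma expR_Ndelta_lt1 (l : R) : 0 < l -> expR (- delta * l) < 1.
Proof. by move=> l0; rewrite expR_lt1 mulNr oppr_lt0 mulr_gt0. Qed.

(** Sum over the windows ending at [t]: the n-th one contributes at most
    [M q^n C] with [q = exp (- delta l)]. *)
Lemma exp_weight_window (h : R -> R) (l C t : R) :
  measurable_fun setT h -> (forall s, 0 <= h s) -> 0 < l -> 0 <= C ->
  (forall xi : R, \int[mu]_(s in `[xi, (xi + l)%R]) (h s)%:E <= C%:E)%E ->
  (\int[mu]_(s in `]-oo, t]) (exp_weight t s * h s)%:E <=
    (M * C / (1 - expR (- delta * l)))%:E)%E.
Proof.
move=> mh h0 l0 C0 hC; set q := expR _.
have q1 : q < 1 by exact: expR_Ndelta_lt1.
have q0 : 0 < q by exact: expR_gt0.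
have M0 : 0 <= M by exact: le_trans M_ge1.
set B := M * C / (1 - q).
have BE : B * (1 - q) = M * C by rewrite /B divfK// gt_eqF// subr_gt0.
have B0 : 0 <= B by rewrite /B divr_ge0 ?mulr_ge0// subr_ge0 ltW.
have mwh (D : set R) : measurable_fun D (fun s => (exp_weight t s * h s)%:E).
  apply/measurable_EFinP; apply: measurable_funM; first exact: measurable_exp_weight.
  exact: measurable_funTS.
have wh0 s : (0 <= (exp_weight t s * h s)%:E)%E.
  by rewrite lee_fin mulr_ge0// exp_weight_ge0.
pose F (n : nat) : set R := `]t - n%:R * l, t]%classic.
have FS n : F n.+1 = `]t - n.+1%:R * l, t - n%:R * l]%classic `|` F n.
  rewrite /F -itv_bndbnd_setU ?bnd_simp//.
    by rewrite lerD2l lerN2 ler_wpM2r ?ler_nat// ltW.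
  by rewrite gerBl mulr_ge0// ltW.
have bound n : (\int[mu]_(s in F n) (exp_weight t s * h s)%:E <= (B * (1 - q ^+ n))%:E)%E.
  elim: n => [|n IH].
    by rewrite /F mul0r subr0 set_itvoc0 integral_set0 expr0 subrr mulr0.
  have disj : [disjoint `]t - n.+1%:R * l, t - n%:R * l]%classic & F n].
    apply/disj_setPS => s [] /=; rewrite !in_itv/= => /andP[_ s1] /andP[s2 _].
    by move: (lt_le_trans s2 s1); rewrite ltxx.
  have mFn : measurable (F n : set (measurableTypeR R)) by exact: measurable_itv.
  rewrite FS (ge0_integral_setU _ _ mFn (mwh _) _ disj)//.
  have -> : B * (1 - q ^+ n.+1) = M * q ^+ n * C + B * (1 - q ^+ n).
    have -> : M * q ^+ n * C = B * (1 - q) * q ^+ n by rewrite BE; ring.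
    by rewrite exprS; ring.
  rewrite EFinD; apply: leeD => //.
  apply: (@le_trans _ _ (\int[mu]_(s in `](t - n.+1%:R * l)%R, (t - n%:R * l)%R])
      ((M * q ^+ n)%:E * (h s)%:E))%E).
    apply: ge0_le_integral => //.
    - exact: mwh.
    - by apply: measurable_funeM; apply/measurable_EFinP; exact: measurable_funTS.
    - move=> s; rewrite /= in_itv/= => /andP[_ sl].
      rewrite -EFinM lee_fin ler_wpM2r// ler_wpM2l//.
      rewrite /q -expRM_natl ler_expR.
      have : delta * (n%:R * l) <= delta * (t - s) by apply: (ler_wpM2l (ltW delta_gt0)); lra.
      lra.
  rewrite ge0_integralZl//; last 3 first.
  - by apply/measurable_EFinP; exact: measurable_funTS.
  - by move=> s _; rewrite lee_fin.
  - by rewrite lee_fin mulr_ge0// exprn_ge0// ltW.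
  rewrite [leRHS]EFinM lee_wpmul2l ?lee_fin ?mulr_ge0 ?exprn_ge0// ?(ltW q0)//.
  apply: le_trans (hC (t - n.+1%:R * l)); apply: ge0_subset_integral => //.
  - by apply/measurable_EFinP; exact: measurable_funTS.
  - by move=> s _; rewrite lee_fin.
  - move=> s; rewrite /= !in_itv/= => /andP[/ltW -> sl]/=.
    by apply: le_trans sl _; rewrite -natr1; lra.
have FU : `]-oo, t]%classic = \bigcup_n F n.
  apply/seteqP; split => s; rewrite /= in_itv/=; last first.
    by move=> [n _]; rewrite /F/= in_itv/= => /andP[].
  move=> st; have [n _ nP] := nbhs_infty_ger ((t - s + 1) / l).
  exists n => //; rewrite /F/= in_itv/= st andbT.
  by have := nP n (leqnn n); rewrite /= ler_pdivrMr//; lra.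
have ndF : nondecreasing_seq F.
  by apply/nondecreasing_seqP => n; rewrite FS subsetEset; exact: subsetUr.
have cv := @ge0_nondecreasing_set_cvg_integral _ (measurableTypeR R) R F
  (fun s => (exp_weight t s * h s)%:E) mu ndF (fun n => measurable_itv _)
  (fun n => mwh (F n)) (fun n s _ => wh0 s).
rewrite FU; apply: (cvge_to_le cv); apply: nearW => n.
apply: le_trans (bound n) _.
by rewrite lee_fin ler_piMr// gerBl exprn_ge0// ltW.
Qed.

(** A bound for the total mass of the weight, namely the window bound for the
    constant function 1 and windows of length 1. *)
Definition exp_mass : R := M / (1 - expR (- delta)).

Lemma exp_mass_gt0 : 0 < exp_mass.
Proof.
rewrite divr_gt0 ?(lt_le_trans ltr01 M_ge1)// subr_gt0.
by rewrite -[- delta]mulr1 expR_Ndelta_lt1.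
Qed.

Lemma integral_exp_weight t :
  (\int[mu]_(s in `]-oo, t]) (exp_weight t s)%:E <= exp_mass%:E)%E.
Proof.
have := @exp_weight_window (cst 1) 1 1 t (measurable_cst _) (fun=> ler01) ltr01 ler01.
rewrite !mulr1 /exp_mass; under eq_integral do rewrite mulr1; apply.
move=> xi; rewrite (integral_cst mu (measurable_itv _) 1%:E) mul1e.
rewrite [leLHS]lebesgue_measure_itv/= lte_fin ltrDl ltr01.
by rewrite -EFinB addrC addKr.
Qed.

Definition exp_conv (h : R -> R) (t : R) : \bar R :=
  (\int[mu]_(s in `]-oo, t]) (exp_weight t s * h s)%:E)%E.

Lemma exp_convE (h : R -> R) t :
  measurable_fun setT h -> (forall s, 0 <= h s) ->
  (exp_conv h t = \int[mu]_(r in `]-oo, 0%R]) (exp_weight 0 r * h (r + t)%R)%:E)%E.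
Proof.
move=> mh h0.
have mF : measurable_fun (`]-oo, t]%classic : set R)
    (fun s : R => (exp_weight t s * h s)%:E).
  apply/measurable_EFinP; apply: measurable_funM; first exact: measurable_exp_weight.
  exact: measurable_funTS.
have F0 s : (0 <= (exp_weight t s * h s)%:E)%E.
  by rewrite lee_fin mulr_ge0// exp_weight_ge0.
rewrite /exp_conv (ge0_integral_translate t (measurable_itv _) mF F0).
rewrite (_ : translate t @^-1` _ = `]-oo, 0%R]%classic).
  by apply: eq_integral => r _; rewrite exp_weight_translate.
apply/seteqP; split => s; rewrite /= /translate !in_itv/=; lra.
Qed.

Lemma measurable_exp_kernel (h : R -> R) : measurable_fun setT h ->
  measurable_fun setT (fun z : measurableTypeR R * measurableTypeR R =>
    (exp_weight 0 z.2 * h (z.2 + z.1)%R)%:E).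
Proof.
move=> mh; apply/measurable_EFinP; apply: measurable_funM.
  exact: (measurableT_comp (@measurable_exp_weight 0 setT) measurable_snd).
apply: (measurableT_comp mh); exact: measurable_funD.
Qed.

Lemma measurable_exp_conv (h : R -> R) :
  measurable_fun setT h -> (forall s, 0 <= h s) ->
  measurable_fun setT (exp_conv h).
Proof.
move=> mh h0.
have -> : exp_conv h = fun t => (\int[mu]_(r in `]-oo, 0%R]) (exp_weight 0 r * h (r + t)%R)%:E)%E.
  by apply/funext => t; exact: exp_convE.
apply: (measurable_integral_slice (measurable_exp_kernel mh)) => // z.
by rewrite lee_fin mulr_ge0// exp_weight_ge0.
Qed.

(** Young's inequality for the exponential kernel, uniformly over windows of a
    fixed length: by convexity the p-th power moves inside the average, and
    exchanging the integrals leaves averages of translated windows. *)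
Lemma exp_conv_window_Lp (h : R -> R) (p l C : R) :
  measurable_fun setT h -> (forall s, 0 <= h s) -> 1 <= p -> 0 <= C ->
  (forall t, exp_conv h t < +oo)%E ->
  (forall xi : R, \int[mu]_(s in `[xi, (xi + l)%R]) (h s `^ p)%:E <= C%:E)%E ->
  forall xi : R, (\int[mu]_(t in `[xi, (xi + l)%R]) (fine (exp_conv h t) `^ p)%:E
    <= (exp_mass `^ p * C)%:E)%E.
Proof.
move=> mh h0 p1 C0 fin hC xi.
have W0 := exp_mass_gt0.
have mcv := measurable_exp_conv mh h0.
pose k s := h s `^ p.
have k0 s : 0 <= k s by exact: powR_ge0.
have mk : measurable_fun setT k by exact: (measurableT_comp (measurable_powR p) mh).
have mK := measurable_exp_kernel mk.
pose G (z : measurableTypeR R * measurableTypeR R) :=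
  (exp_weight 0 z.2 * k (z.2 + z.1)%R)%:E.
have G0 z : (0 <= G z)%E by rewrite lee_fin mulr_ge0// exp_weight_ge0.
have mtr t : measurable_fun setT (fun r : R => r + t) by exact: measurable_funD.
have jensen t : ((fine (exp_conv h t) `^ p)%:E <=
    (exp_mass `^ (p - 1))%:E * \int[mu]_(r in `]-oo, 0%R]) G (t, r))%E.
  apply: (@weighted_jensen R _ (measurableTypeR R) mu _ (exp_weight 0) (fun r => h (r + t))) => //.
  - exact: measurable_exp_weight.
  - by apply: measurable_funTS; exact: (measurableT_comp mh (mtr t)).
  - by move=> r; exact: exp_weight_ge0.
  - exact: integral_exp_weight.
  - rewrite -exp_convE// fineK// ge0_fin_numE//; apply: integral_ge0 => s _.
    by rewrite lee_fin mulr_ge0// exp_weight_ge0.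
have mslice := measurable_integral_slice mK G0 (measurable_itv `]-oo, 0%R]).
apply: (@le_trans _ _ (\int[mu]_(t in `[xi, (xi + l)%R])
    ((exp_mass `^ (p - 1))%:E * \int[mu]_(r in `]-oo, 0%R]) G (t, r)))%E).
  apply: ge0_le_integral => //.
  - by move=> t _; rewrite lee_fin powR_ge0.
  - apply/measurable_EFinP; apply: measurable_funTS.
    apply: (measurableT_comp (measurable_powR p)).
    exact: (measurableT_comp (fine_measurable measurableT) mcv).
  - by apply: measurable_funeM; exact: measurable_funTS.
rewrite ge0_integralZl//; last 3 first.
- exact: measurable_funTS.
- by move=> t _; exact: integral_ge0.
- by rewrite lee_fin powR_ge0.
rewrite (powR_predr p W0) -mulrA EFinM lee_wpmul2l ?lee_fin ?powR_ge0//.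
rewrite ge0_restricted_tonelli//.
have inner r : (\int[mu]_(t in `[xi, (xi + l)%R]) G (t, r) <= (exp_weight 0 r)%:E * C%:E)%E.
  under eq_integral do rewrite /G/= EFinM.
  rewrite ge0_integralZl//; last 3 first.
  - apply/measurable_EFinP/measurable_funTS.
    by apply: (measurableT_comp mk); exact: measurable_funD.
  - by move=> t _; rewrite lee_fin.
  - by rewrite lee_fin exp_weight_ge0.
  rewrite lee_wpmul2l ?lee_fin ?exp_weight_ge0//.
  apply: le_trans (hC (xi + r)); rewrite (ge0_integral_translate r)//.
  - have -> : translate r @^-1` `[(xi + r)%R, (xi + r + l)%R]%classic = `[xi, (xi + l)%R]%classic.
      apply/seteqP; split => s; rewrite /= /translate !in_itv/= => /andP[? ?]; apply/andP; split; lra.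
    by under eq_integral do rewrite addrC.
  - by apply/measurable_EFinP/measurable_funTS.
apply: (@le_trans _ _ (\int[mu]_(r in `]-oo, 0%R]) (C%:E * (exp_weight 0 r)%:E))%E).
  apply: ge0_le_integral => //.
  - by move=> r _; exact: integral_ge0.
  - apply: measurable_funTS.
    have mswap : measurable_fun setT (G \o unstable.swap).
      exact: (measurableT_comp mK (@measurable_swap _ _ _ _)).
    exact: (measurable_integral_slice mswap (fun z => G0 (unstable.swap z)) (measurable_itv `[xi, xi + l])).
  - by apply: measurable_funeM; apply/measurable_EFinP; exact: measurable_exp_weight.
  - by move=> r _; rewrite muleC; exact: inner.
rewrite ge0_integralZl//; last 2 first.
- by apply/measurable_EFinP; exact: measurable_exp_weight.
- by move=> r _; rewrite lee_fin exp_weight_ge0.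
by rewrite mulrC EFinM lee_wpmul2l ?lee_fin// integral_exp_weight.
Qed.

End ExponentialWeight.

(** * Exponentially stable semigroups *)

Lemma limit_of_simple_continuous {d : measure_display} {S : measurableType d}
    {R : realType} {X : completeNormedModType R} (L : X -> X) (f : S -> X) :
  continuous L -> limit_of_simple f -> limit_of_simple (L \o f).
Proof.
move=> cL [r [sr rf]]; exists (fun n => L \o r n); split.
  by move=> n; exact: (simple_map_comp L (sr n)).
by move=> t; apply: (cvg_comp _ _ (rf t)); exact: cL.
Qed.

Section OperatorNorm.
Context {R : realType} {X : completeNormedModType R}.

(** The operator norm tests vectors of the unit ball; homogeneity gives the
    bound everywhere. *)
Lemma op_norm_le (L : X -> X) (c : R) : linear L ->
  (op_norm L <= c%:E)%E -> forall x, `|L x| <= c * `|x|.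
Proof.
move=> linL Lc x.
have L0 : L 0 = 0.
  by have := linL (-1) 0 0; rewrite scaler0 addr0 scaleN1r addNr.
have [->|x0] := eqVneq x 0; first by rewrite L0 !normr0 mulr0.
have nx : 0 < `|x| by rewrite normr_gt0.
have Ly : `|L (`|x|^-1 *: x)| <= c.
  rewrite -lee_fin; apply: le_trans Lc; apply: ereal_sup_ubound.
  exists (`|x|^-1 *: x) => //=.
  by rewrite normrZ normfV normr_id mulVf// gt_eqF.
have := linL (`|x|^-1) x 0; rewrite L0 !addr0 => E; move: Ly.
by rewrite E normrZ normfV normr_id mulrC ler_pdivrMr.
Qed.

End OperatorNorm.

Section StableSemigroup.
Context {R : realType} {X : completeNormedModType R}.
Variables (T : R -> X -> X) (delta M : R).
Hypothesis T_C0 : C0_semigroup T.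
Hypotheses (delta_gt0 : 0 < delta) (M_ge1 : 1 <= M).
Hypothesis T_bound :
  forall t x, 0 <= t -> `|T t x| <= M * expR (- delta * t) * `|x|.

(** Extending by the identity to negative times makes [(r, x) |-> T r x] total
    and jointly continuous. *)
Definition extend (r : R) : X -> X := T (Num.max r 0).

Let M_ge0 : 0 <= M. Proof. exact: le_trans M_ge1. Qed.

Lemma semigroup_linear t : 0 <= t -> linear (T t).
Proof. by case: T_C0 => + _ _ _ t0 => /(_ _ t0) []. Qed.

Lemma semigroup_continuous t : 0 <= t -> continuous (T t).
Proof. by case: T_C0 => + _ _ _ t0 => /(_ _ t0) []. Qed.

Lemma semigroupB t x y : 0 <= t -> T t (x - y) = T t x - T t y.
Proof.
move=> t0; have := semigroup_linear t0 (-1) y x.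
by rewrite !scaleN1r [- y + x]addrC => ->; rewrite addrC.
Qed.

Lemma semigroup_le t x : 0 <= t -> `|T t x| <= M * `|x|.
Proof.
move=> t0; apply: le_trans (T_bound x t0) _; rewrite ler_wpM2r//.
by rewrite ler_piMr// -[leRHS]expR0 ler_expR mulNr oppr_le0 mulr_ge0// ltW.
Qed.

Lemma semigroup_near0 x (e : R) : 0 < e ->
  exists2 eta, 0 < eta & forall h, 0 <= h -> h < eta -> `|T h x - x| < e.
Proof.
move=> e0; case: T_C0 => _ T0 _ /(_ x) /cvgrPdist_lt /(_ _ e0).
move=> /nbhs_ballP [eta eta0 H]; exists eta => // h; rewrite le_eqVlt.
case/orP => [/eqP <- _|h0 heta]; first by rewrite T0 subrr normr0.
rewrite distrC; apply: H => //=.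
by rewrite -ball_normE/= sub0r normrN gtr0_norm.
Qed.

Lemma extend_bound t s x : s <= t ->
  `|extend (t - s) x| <= exp_weight delta M t s * `|x|.
Proof.
by move=> st; rewrite /extend max_l ?subr_ge0//; apply: T_bound; rewrite subr_ge0.
Qed.

Lemma extend_le r x : `|extend r x| <= M * `|x|.
Proof. by apply: semigroup_le; rewrite le_max lexx orbT. Qed.

Lemma extendB r x y : extend r (x - y) = extend r x - extend r y.
Proof. by apply: semigroupB; rewrite le_max lexx orbT. Qed.

(** The semigroup law writes the difference of two orbit values as a uniformly
    bounded operator applied to [T h x - x] with [h <= |r - s|]. *)
Lemma extend_near x (e : R) : 0 < e ->
  exists2 eta, 0 < eta &
    forall r s, `|r - s| < eta -> `|extend r x - extend s x| <= M * e.
Proof.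
move=> e0; have [eta eta0 H] := semigroup_near0 x e0; exists eta => // r s.
wlog sr : r s / s <= r.
  move=> W rs; have [sr|/ltW rs'] := leP s r; first exact: W.
  by rewrite distrC; apply: W => //; rewrite distrC.
move=> rs; rewrite /extend; set b := Num.max r 0; set a := Num.max s 0.
have a0 : 0 <= a by rewrite le_max lexx orbT.
have ab : 0 <= b - a.
  by rewrite subr_ge0 ge_max !le_max sr lexx orbT.
have ba : b - a < eta.
  apply: le_lt_trans rs; rewrite ger0_norm ?subr_ge0// /a /b /Num.max.
  by case: ifPn; case: ifPn; rewrite -?leNgt; lra.
have -> : T b x = T a (T (b - a) x).
  by case: T_C0 => _ _ /(_ a (b - a) a0 ab) + _; rewrite addrC subrK => ->.
rewrite -semigroupB//; apply: le_trans (semigroup_le _ a0) _.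
by rewrite ler_wpM2l// ltW// H.
Qed.

Lemma extend_cvg (r : nat -> R) (x : nat -> X) r0 x0 :
  r n @[n --> \oo] --> r0 -> x n @[n --> \oo] --> x0 ->
  extend (r n) (x n) @[n --> \oo] --> extend r0 x0.
Proof.
move=> /cvgrPdist_lt rr0 /cvgrPdist_lt xx0.
have M0 : 0 < M by exact: lt_le_trans M_ge1.
apply/cvgrPdist_le => e e0.
have e2 : 0 < e / (2 * M) by rewrite divr_gt0// mulr_gt0.
have [eta eta0 H] := extend_near x0 e2.
near=> n.
have -> : extend r0 x0 - extend (r n) (x n) =
    (extend r0 x0 - extend (r n) x0) + extend (r n) (x0 - x n).
  by rewrite extendB addrA subrK.
apply: le_trans (ler_normD _ _) _.
have -> : e = M * (e / (2 * M)) + M * (e / (2 * M)) by field; rewrite gt_eqF.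
apply: lerD; first by apply: H; near: n; exact: rr0.
apply: le_trans (extend_le _ _) _; rewrite ler_wpM2l//.
by near: n; have := xx0 _ e2; apply: filterS => n; exact: ltW.
Unshelve. all: by end_near.
Qed.

(** Joint continuity allows the time and the vector to be discretised
    separately: a step function of the time paired with one of the vector. *)
Lemma limit_of_simple_extend (g : measurableTypeR R -> X) (t : R) :
  limit_of_simple g -> limit_of_simple (fun s : measurableTypeR R => extend (t - s) (g s)).
Proof.
move=> [s [ss sg]]; exists (fun n r => extend (t - grid n r) (s n r)); split.
  move=> n; apply: (simple_map2 (fun a => extend (t - a)) (simple_map_grid n)).
  exact: ss.
move=> r; apply: extend_cvg; last exact: sg.
by apply: cvgB; [exact: cvg_cst|exact: cvg_grid].
Qed.

(** * The solution as an integral over the past *)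

Section Convolution.
Local Notation mu := (@lebesgue_measure R).

Definition window_bounded (l C : R) (g : R -> X) : Prop :=
  forall xi : R, (\int[mu]_(s in `[xi, (xi + l)%R]) (`|g s|)%:E <= C%:E)%E.

Variables (g : measurableTypeR R -> X) (l C : R).
Hypothesis g_lim : limit_of_simple g.
Hypotheses (l_gt0 : 0 < l) (C_ge0 : 0 <= C) (g_window : window_bounded l C g).

Let F (t : R) : measurableTypeR R -> X := fun s => extend (t - s) (g s).

Definition past_integral (t : R) : X := bochner_integral mu `]-oo, t] (F t).

Let F_lim t : limit_of_simple (F t). Proof. exact: limit_of_simple_extend. Qed.

Lemma exp_conv_fin t :
  (exp_conv delta M (fun s => `|g s|%R) t <=
    (M * C / (1 - expR (- delta * l)))%:E)%E.
Proof.
apply: exp_weight_window => //; exact: (measurable_norm_limit g_lim).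
Qed.

Lemma integral_extend_le (h : measurableTypeR R -> X) t : limit_of_simple h ->
  (\int[mu]_(s in `]-oo, t]) (`|extend (t - s) (h s)|)%:E <=
    exp_conv delta M (fun s => `|h s|%R) t)%E.
Proof.
move=> lh; apply: ge0_le_integral => //.
- exact: measurable_enorm_limit (limit_of_simple_extend t lh).
- apply/measurable_EFinP; apply: measurable_funM.
    exact: measurable_exp_weight.
  exact: measurable_norm_limit.
- by move=> s; rewrite /= in_itv/= lee_fin; exact: extend_bound.
Qed.

Let mhalf t : measurable (`]-oo, t]%classic : set (measurableTypeR R)).
Proof. exact: measurable_itv. Qed.

Let F_int t : (\int[mu]_(s in `]-oo, t]) (`|F t s|)%:E < +oo)%E.
Proof.
apply: le_lt_trans (integral_extend_le t g_lim) _.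
by apply: le_lt_trans (exp_conv_fin t) _; rewrite ltry.
Qed.

Let F_intS t (D : set (measurableTypeR R)) : measurable D -> D `<=` `]-oo, t] ->
  (\int[mu]_(s in D) (`|F t s|)%:E < +oo)%E.
Proof.
move=> mD Dt; apply: le_lt_trans (F_int t); apply: ge0_subset_integral => //.
exact: (measurable_enorm_limit (F_lim t)).
Qed.

Lemma past_integralP t : is_bochner_integral mu `]-oo, t] (F t) (past_integral t).
Proof. exact: (bochner_integralP (mhalf t) (F_lim t) (F_int t)). Qed.

Lemma norm_past_integral_le t : `|past_integral t| <= M * C / (1 - expR (- delta * l)).
Proof.
rewrite -lee_fin; apply: le_trans (exp_conv_fin t).
apply: le_trans (integral_extend_le t g_lim).
exact: (norm_is_bochner_integral (mhalf t) (F_lim t) (past_integralP t)).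
Qed.

Lemma extend_integrable_half_line t :
  bochner_integrable mu `]-oo, t] (F t).
Proof. exact: limit_bochner_integrable. Qed.

Lemma extend_integrable_itv a t :
  bochner_integrable mu `[a, t] (F t).
Proof.
apply: limit_bochner_integrable => //; apply: F_intS => // s.
by rewrite /= !in_itv/= => /andP[].
Qed.

(** Split the half-line at [a]; on the left part the semigroup law lets
    [T (t - a)] be taken out of the integral. *)
Lemma past_integral_step a t : a <= t ->
  past_integral t = T (t - a) (past_integral a) + bochner_integral mu `[a, t] (F t).
Proof.
move=> at_; have ta0 : 0 <= t - a by rewrite subr_ge0.
have mA : measurable (`]-oo, a]%classic : set (measurableTypeR R)) by exact: measurable_itv.
have mB : measurable (`[a, t]%classic : set (measurableTypeR R)) by exact: measurable_itv.
have AB : `]-oo, t]%classic = `]-oo, a]%classic `|` `[a, t]%classic :> set R.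
  apply/seteqP; split => s; rewrite /= !in_itv/=.
    by have [sa|/ltW as_] := leP s a; [left|right; apply/andP].
  by case=> [/le_trans|/andP[]//]; apply.
have AB0 : mu (`]-oo, a]%classic `&` `[a, t]%classic) = 0%E.
  apply: (@subset_measure0 _ _ _ mu _ [set a]) => //.
  - exact: measurableI.
  - move=> s [] /=; rewrite !in_itv/= => sa /andP[as_ _].
    by apply/eqP; rewrite eq_le sa.
  - exact: lebesgue_measure_set1.
rewrite /past_integral AB bochner_integralU//; last by rewrite -AB.
congr (_ + _).
pose L : {linear X -> X} :=
  HB.pack (T (t - a)) (GRing.isLinear.Build R X X *:%R (T (t - a)) (semigroup_linear ta0)).
have cL : continuous L by exact: semigroup_continuous.
rewrite (@bochner_integral_ae _ _ _ _ mu _ (F t) (L \o F a)); last first.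
  apply: aeW => s; rewrite /= in_itv/= => sa; rewrite /F /extend.
  rewrite !max_l ?subr_ge0 ?(le_trans sa)//.
  case: T_C0 => _ _ /(_ (t - a) (a - s) ta0) + _.
  by rewrite subr_ge0 => /(_ sa); rewrite addrA subrK => ->.
apply: bochner_integral_unique => //; first exact: limit_of_simple_continuous.
apply: (is_bochner_integral_linear (c := M)) => //; last exact: past_integralP.
by move=> x; exact: semigroup_le.
Qed.

(** The increment from [t] to [b] is [(T (b - t) - 1)] applied to the value at
    [t], plus an integral over [[t, b]]; the first is small by strong
    continuity, the second by absolute continuity of the integral. *)
Lemma past_integral_right_continuous t (b : nat -> R) :
  (\forall n \near \oo, t <= b n) -> b n @[n --> \oo] --> t ->
  past_integral (b n) @[n --> \oo] --> past_integral t.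
Proof.
move=> tb bt.
have mg D : measurable_fun D (fun s : measurableTypeR R => `|g s|).
  exact: (measurable_norm_limit g_lim).
have ig : mu.-integrable `[t, t + l] (EFin \o (fun s => `|g s|)).
  apply/integrableP; split; first exact/measurable_EFinP.
  apply: le_lt_trans (_ : _ <= C%:E)%E (ltry _).
  apply: le_trans (g_window t); rewrite le_eqVlt; apply/orP; left; apply/eqP.
  by apply: eq_integral => s _; rewrite /= normr_id.
have small : parameterized_integral mu t (b n) (fun s => `|g s|) @[n --> \oo] --> 0.
  apply: (cvg_comp b (fun x => parameterized_integral mu t x (fun s => `|g s|)) bt).
  by apply: (parameterized_integral_cvg_left (b := t + l)) => //; rewrite ltrDl.
have diff n : t <= b n -> b n <= t + l ->
    `|past_integral t - past_integral (b n)| <= `|past_integral t - T (b n - t) (past_integral t)| +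
      M * parameterized_integral mu t (b n) (fun s => `|g s|).
  move=> tbn bntl; rewrite (past_integral_step tbn) opprD addrA.
  apply: le_trans (ler_normB _ _) _; rewrite lerD2l.
  have finI : (\int[mu]_(s in `[t, b n]) (`|g s|)%:E)%E \is a fin_num.
    rewrite ge0_fin_numE; last by apply: integral_ge0.
    apply: le_lt_trans (ltry C); apply: le_trans (g_window t).
    apply: ge0_subset_integral => //; first exact/measurable_EFinP.
    by move=> s; rewrite /= !in_itv/= => /andP[-> /le_trans]; apply.
  rewrite -lee_fin EFinM /parameterized_integral /Rintegral fineK//.
  rewrite -ge0_integralZl//; last by exact/measurable_EFinP.
  apply: le_trans (_ : _ <= \int[mu]_(s in `[t, b n]) (`|F (b n) s|)%:E)%E _.
    apply: norm_is_bochner_integral => //.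
    apply: bochner_integralP => //; apply: F_intS => // s.
    by rewrite /= !in_itv/= => /andP[].
  apply: ge0_le_integral => //.
  - exact: (measurable_enorm_limit (F_lim _)).
  - by apply: measurable_funeM; exact/measurable_EFinP.
  - by move=> s _; rewrite -EFinM lee_fin extend_le.
have orb : T (b n - t) (past_integral t) @[n --> \oo] --> past_integral t.
  have T0 : extend 0 (past_integral t) = past_integral t.
    by rewrite /extend maxxx; case: T_C0 => _ -> _ _.
  rewrite -{2}T0.
  have : extend (b n - t) (past_integral t) @[n --> \oo] --> extend 0 (past_integral t).
    apply: extend_cvg; last exact: cvg_cst.
    by rewrite -(subrr t); apply: cvgB => //; exact: cvg_cst.
  apply: cvg_trans; apply: near_eq_cvg; apply: filterS tb => n tbn.
  by rewrite /extend max_l// subr_ge0.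
apply/cvgrPdist_le => e e0.
have e2 : 0 < e / 2 by rewrite divr_gt0.
have M0 : 0 < M by exact: lt_le_trans M_ge1.
near=> n.
have tbn : t <= b n by near: n.
have btn : b n <= t + l.
  by near: n; apply: (cvgr_le _ bt); rewrite ltrDl.
apply: le_trans (diff n tbn btn) _; rewrite [e]splitr; apply: lerD.
  by near: n; move/cvgrPdist_le: orb; apply.
rewrite mulrC -ler_pdivlMr//.
by near: n; apply: (cvgr_le _ small); rewrite divr_gt0.
Unshelve. all: by end_near.
Qed.

Lemma past_integral_limit_of_simple : limit_of_simple (past_integral : measurableTypeR R -> X).
Proof.
exists (fun n s => past_integral (grid n s)); split.
  by move=> n; exact: (simple_map_comp past_integral (simple_map_grid n)).
move=> t; apply: past_integral_right_continuous; last exact: cvg_grid.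
by have := near_grid_bounds t; apply: filterS => n /andP[/ltW].
Qed.

(** Translating the half-line turns the increment of the solution into the
    convolution of the increment of the forcing term. *)
Lemma norm_past_integral_translate_le tau t :
  ((`|past_integral (t + tau) - past_integral t|)%:E <=
    exp_conv delta M (fun s => `|g (s + tau) - g s|%R) t)%E.
Proof.
have lgt : limit_of_simple (g \o translate tau).
  exact: (limit_of_simple_comp (@measurable_translate R tau) g_lim).
have H : is_bochner_integral mu `]-oo, t]
    (fun s => extend (t - s) (g (s + tau))) (past_integral (t + tau)).
  have := is_bochner_integral_comp (@measurable_translate R tau) (range_translate tau)
    (@lebesgue_measure_translate R tau) (mhalf _) (F_lim (t + tau)) (past_integralP (t + tau)).
  rewrite (_ : translate tau @^-1` _ = `]-oo, t]%classic); last first.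
    by apply/seteqP; split => s; rewrite /= /translate !in_itv/= lerD2r.
  rewrite (_ : F (t + tau) \o translate tau = fun s => extend (t - s) (g (s + tau)))//.
  apply/funext => s; rewrite /F /= /translate; congr (extend _ _).
  by rewrite opprD addrACA subrr addr0.
have lH := limit_of_simple_extend t lgt.
have D := is_bochner_integralB (mhalf t) lH (F_lim t) H (past_integralP t).
apply: le_trans (norm_is_bochner_integral (mhalf t) (limit_of_simpleB lH (F_lim t)) D) _.
rewrite [leLHS](_ : _ = \int[mu]_(s in `]-oo, t]) (`|extend (t - s) (g (s + tau) - g s)|)%:E)%E.
  exact: (integral_extend_le t (limit_of_simpleB lgt g_lim)).
by apply: eq_integral => s _; rewrite extendB.
Qed.

End Convolution.

End StableSemigroup.

(** * Weyl almost periods and windows *)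

#[local] Instance lebesgue_ae_filter (R : realType) :
  Filter (nbhs (almost_everywhere (@lebesgue_measure R))).
Proof. exact: ae_filter_ringOfSetsType. Qed.

Section WeylDistance.
Context {R : realType} {X : completeNormedModType R}.
Local Notation mu := (@lebesgue_measure R).
Implicit Types (p l tau e : R) (g : R -> X).

Lemma integral_norm_powR_ge0 (D : set (measurableTypeR R)) p (h : R -> X) :
  (0 <= \int[mu]_(t in D) (`|h t| `^ p)%:E)%E.
Proof. by apply: integral_ge0 => t _; rewrite lee_fin powR_ge0. Qed.

Lemma weyl_dist_lt_window p l tau e g : 1 <= p -> 0 < l -> 0 <= e ->
  (weyl_dist p l tau g < e%:E)%E -> forall xi : R,
  (\int[mu]_(t in `[xi, (xi + l)%R]) (`|g (t + tau) - g t| `^ p)%:E <=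
    (l * e `^ p)%:E)%E.
Proof.
move=> p1 l0 e0 dist xi; have p0 : 0 < p by exact: lt_le_trans p1.
set I := (\int[mu]_(t in _) _)%E.
have I0 : (0 <= I)%E by exact: (integral_norm_powR_ge0 _ p (fun t => g (t + tau) - g t)).
have J0 : (0 <= (l^-1)%:E * I)%E by rewrite mule_ge0// lee_fin invr_ge0 ltW.
have le_e : ((((l^-1)%:E * I) `^ p^-1) <= e%:E)%E.
  by apply: ltW; apply: le_lt_trans dist; apply: ereal_sup_ubound; exists xi.
have : ((l^-1)%:E * I <= (e `^ p)%:E)%E.
  rewrite -[leLHS]poweRe1// -(mulVf (lt0r_neq0 p0)) poweRrM -poweR_EFin.
  apply: gt0_ler_poweR le_e; rewrite ?ltW// in_itv/= ?leey ?andbT//.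
  exact: poweR_ge0.
move=> /(lee_wpmul2l (_ : 0 <= l%:E)%E); rewrite lee_fin => /(_ (ltW l0)).
by rewrite muleA -EFinM mulfV ?gt_eqF// mul1e -EFinM.
Qed.

Lemma weyl_dist_le_window p l tau e g : 1 <= p -> 0 < l -> 0 <= e ->
  (forall xi : R,
    (\int[mu]_(t in `[xi, (xi + l)%R]) (`|g (t + tau) - g t| `^ p)%:E <=
      (l * e `^ p)%:E)%E) ->
  (weyl_dist p l tau g <= e%:E)%E.
Proof.
move=> p1 l0 e0 win; have p0 : 0 < p by exact: lt_le_trans p1.
apply: ge_ereal_sup => _ [xi _ <-].
have := win xi; set I := (\int[mu]_(t in _) _)%E => Ile.
have I0 : (0 <= I)%E by exact: (integral_norm_powR_ge0 _ p (fun t => g (t + tau) - g t)).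
have J0 : (0 <= (l^-1)%:E * I)%E by rewrite mule_ge0// lee_fin invr_ge0 ltW.
have {}Ile : ((l^-1)%:E * I <= (e `^ p)%:E)%E.
  have := lee_wpmul2l (_ : 0 <= (l^-1)%:E)%E Ile.
  by rewrite lee_fin invr_ge0 -EFinM mulKf ?gt_eqF//; apply; exact: ltW.
have -> : (e%:E = (e `^ p)%:E `^ p^-1)%E.
  by rewrite poweR_EFin -powRrM mulfV ?gt_eqF// powRr1.
apply: gt0_ler_poweR; rewrite ?invr_ge0 ?(ltW p0)// ?in_itv/= ?leey ?andbT//.
by rewrite lee_fin powR_ge0.
Qed.

Lemma weyl_window_ae p l tau xi (f g : R -> X) :
  {ae mu, forall t, f t = g t} ->
  (\int[mu]_(t in `[xi, (xi + l)%R]) (`|f (t + tau) - f t| `^ p)%:E =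
   \int[mu]_(t in `[xi, (xi + l)%R]) (`|g (t + tau) - g t| `^ p)%:E)%E.
Proof.
move=> fg; apply: ge0_eq_integral_ae.
- by move=> t _; rewrite lee_fin powR_ge0.
- by move=> t _; rewrite lee_fin powR_ge0.
- have fgt : {ae mu, forall t, f (t + tau) = g (t + tau)}.
    exact: (@ae_translate R tau (fun t => f t = g t) fg).
  by apply: filterS2 fg fgt => t E1 E2 _; rewrite E1 E2.
Qed.

End WeylDistance.

Section Windows.
Context {R : realType}.
Local Notation mu := (@lebesgue_measure R).

Lemma lebesgue_measure_window (xi l : R) : 0 < l ->
  mu `[xi, xi + l]%classic = l%:E.
Proof.
move=> l0; rewrite lebesgue_measure_itv/= lte_fin ltrDl l0 -EFinB.
by rewrite addrC addKr.
Qed.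

Lemma powR_le1D (p h : R) : 1 <= p -> 0 <= h -> h <= 1 + h `^ p.
Proof.
move=> p1 h0; have [h1|/ltW h1] := leP h 1.
  by apply: le_trans h1 _; rewrite lerDl powR_ge0.
by apply: le_trans (le1r_powR h1 p1) _; rewrite lerDr.
Qed.

Lemma powRD_le (p a b : R) : 0 <= p -> 0 <= a -> 0 <= b ->
  (a + b) `^ p <= 2 `^ p * (a `^ p + b `^ p).
Proof.
move=> p0 a0 b0; wlog ab : a b a0 b0 / a <= b.
  move=> W; have [|/ltW] := leP a b; first exact: W.
  by rewrite addrC [a `^ p + _]addrC; exact: W.
apply: (@le_trans _ _ ((2 * b) `^ p)).
  by apply: ge0_ler_powR; rewrite ?nnegrE ?addr_ge0 ?mulr_ge0//; lra.
by rewrite powRM// ler_wpM2l ?powR_ge0// lerDr powR_ge0.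
Qed.

Lemma window_Lp_L1 (h : R -> R) (p l C xi : R) : 1 <= p -> 0 < l ->
  measurable_fun setT h -> (forall s, 0 <= h s) ->
  (\int[mu]_(s in `[xi, (xi + l)%R]) (h s `^ p)%:E <= C%:E)%E ->
  (\int[mu]_(s in `[xi, (xi + l)%R]) (h s)%:E <= (l + C)%:E)%E.
Proof.
move=> p1 l0 mh h0 hC.
have mhp : measurable_fun setT (fun s => h s `^ p).
  exact: (measurableT_comp (measurable_powR p) mh).
apply: (@le_trans _ _ (\int[mu]_(s in `[xi, (xi + l)%R]) (1%:E + (h s `^ p)%:E))%E).
  apply: ge0_le_integral => //.
  - by move=> s _; rewrite lee_fin.
  - by apply/measurable_EFinP/measurable_funTS.
  - by apply: emeasurable_funD => //; exact/measurable_EFinP/measurable_funTS.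
  - by move=> s _; rewrite -EFinD lee_fin powR_le1D.
rewrite ge0_integralD//; last 2 first.
- by move=> s _; rewrite lee_fin powR_ge0.
- by apply/measurable_EFinP/measurable_funTS.
rewrite EFinD; apply: leeD => //.
by rewrite (integral_cst mu (measurable_itv _) 1%:E) mul1e [leLHS]lebesgue_measure_window.
Qed.

End Windows.

Section WeylStepanov.
Context {R : realType} {X : completeNormedModType R}.
Local Notation mu := (@lebesgue_measure R).

(** A Weyl almost period moves any window into one fixed compact interval, so
    the window integrals are uniformly bounded. *)
Lemma weyl_window_bounded (p : R) (f g : R -> X) : 1 <= p ->
  limit_of_simple (g : measurableTypeR R -> X) ->
  {ae mu, forall t, f t = g t} -> weyl_almost_periodic p f ->
  exists l C : R, [/\ 0 < l, 0 <= C & window_bounded l C g].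
Proof.
move=> p1 lg fg [[_ loc] wap].
have p0 : 0 < p by exact: lt_le_trans p1.
have [l l0 [k k0 dense]] := wap 1 ltr01.
have mng (D : set (measurableTypeR R)) : measurable_fun D (fun s => `|g s|).
  exact: (measurable_norm_limit lg).
have mgp (D : set (measurableTypeR R)) : measurable_fun D (fun s => (`|g s| `^ p)%:E).
  apply/measurable_EFinP; exact: (measurableT_comp (measurable_powR p) (mng D)).
have [C1 C1E] : exists C1, (\int[mu]_(t in `[0%R, (k + l)%R]) (`|g t| `^ p)%:E = C1%:E)%E.
  exists (fine (\int[mu]_(t in `[0%R, (k + l)%R]) (`|g t| `^ p)%:E)%E).
  rewrite fineK// ge0_fin_numE; last exact: integral_norm_powR_ge0.
  rewrite -(@ge0_eq_integral_ae _ _ _ mu _ (fun t => (`|f t| `^ p)%:E)); first exact: loc.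
  - by move=> t _; rewrite lee_fin powR_ge0.
  - by move=> t _; rewrite lee_fin powR_ge0.
  - by apply: filterS fg => t -> .
have C10 : 0 <= C1 by rewrite -lee_fin -C1E integral_norm_powR_ge0.
(* On a window, [l] bounds the increment of [g] by the almost period and
   [C1] the translated window. *)
pose Cp := 2 `^ p * (l + C1).
have Cp0 : 0 <= Cp by rewrite mulr_ge0 ?powR_ge0// addr_ge0// ltW.
exists l, (l + Cp); split => //; first by rewrite addr_ge0// ltW.
move=> xi; apply: (@window_Lp_L1 _ (fun s => `|g s|) p l Cp xi p1 l0 (mng setT)) => //.
have [tau [/= dist]] := dense (- xi); rewrite in_itv/= => /andP[tau1 tau2].
have win := weyl_dist_lt_window p1 l0 ler01 dist xi.
rewrite powR1 mulr1 (weyl_window_ae _ _ _ _ fg) in win.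
have lgt : limit_of_simple (g \o translate tau : measurableTypeR R -> X).
  exact: (limit_of_simple_comp (@measurable_translate R tau) lg).
have mgt (D : set (measurableTypeR R)) : measurable_fun D (fun s => (`|g (s + tau)| `^ p)%:E).
  apply/measurable_EFinP; apply: (measurableT_comp (measurable_powR p)).
  exact: (measurable_norm_limit lgt).
have mdiff (D : set (measurableTypeR R)) :
    measurable_fun D (fun s => (`|g (s + tau) - g s| `^ p)%:E).
  apply/measurable_EFinP; apply: (measurableT_comp (measurable_powR p)).
  exact: (measurable_norm_limit (limit_of_simpleB lgt lg)).
have shifted : (\int[mu]_(s in `[xi, (xi + l)%R]) (`|g (s + tau)| `^ p)%:E <= C1%:E)%E.
  rewrite -C1E; apply: (@le_trans _ _ (\int[mu]_(s in `[(xi + tau)%R, (xi + l + tau)%R]) (`|g s| `^ p)%:E)%E).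
    rewrite [leRHS](ge0_integral_translate tau)//.
    rewrite (_ : translate tau @^-1` _ = `[xi, xi + l]%classic)//.
    exact: (preimage_translate_itv tau true false xi (xi + l)).
    exact: mgp.
  apply: ge0_subset_integral => //.
  move=> s; rewrite /= !in_itv/= => /andP[s1 s2]; apply/andP; split; lra.
have c0 : (0 <= (2 `^ p)%:E)%E by rewrite lee_fin powR_ge0.
apply: (@le_trans _ _ (\int[mu]_(s in `[xi, (xi + l)%R])
   ((2 `^ p)%:E * ((`|g (s + tau) - g s| `^ p)%:E + (`|g (s + tau)| `^ p)%:E)))%E).
  apply: ge0_le_integral => //.
  - by apply: measurable_funeM; exact: emeasurable_funD.
  - move=> s _; rewrite -EFinD -EFinM lee_fin.
    apply: le_trans (powRD_le (ltW p0) (normr_ge0 _) (normr_ge0 _)).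
    apply: ge0_ler_powR; rewrite ?nnegrE ?addr_ge0 ?(ltW p0)//.
    by rewrite -{1}(subKr (g (s + tau)) (g s)) distrC; apply: le_trans (ler_normB _ _) _; rewrite addrC.
rewrite ge0_integralZl//; last 2 first.
- exact: emeasurable_funD.
- by move=> s _; rewrite -EFinD lee_fin addr_ge0 ?powR_ge0.
rewrite EFinM lee_wpmul2l// ge0_integralD//.
by rewrite EFinD leeD.
Qed.

End WeylStepanov.

(** * Mild solutions *)

Section MildSolutions.
Context {R : realType} {X : completeNormedModType R}.
Local Notation mu := (@lebesgue_measure R).
Variables (T : R -> X -> X) (delta M : R).
Hypothesis T_C0 : C0_semigroup T.
Hypotheses (delta_gt0 : 0 < delta) (M_ge1 : 1 <= M).
Hypothesis T_bound :
  forall t x, 0 <= t -> `|T t x| <= M * expR (- delta * t) * `|x|.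

(** The difference of two mild solutions is an orbit of the semigroup defined
    for all negative times; a bounded such orbit vanishes. *)
Lemma bounded_mild_solution_unique (f u v : R -> X) :
  bounded_fun u -> bounded_fun v ->
  mild_solution T f u -> mild_solution T f v -> u = v.
Proof.
move=> [Bu [_ uB]] [Bv [_ vB]] mu_ mv.
pose B := (`|Bu| + 1) + (`|Bv| + 1).
have duv s : `|u s - v s| <= B.
  apply: le_trans (ler_normB _ _) _; apply: lerD.
    by apply: (uB (`|Bu| + 1)) => //; rewrite (le_lt_trans (ler_norm _))// ltrDl.
  by apply: (vB (`|Bv| + 1)) => //; rewrite (le_lt_trans (ler_norm _))// ltrDl.
have M0 : 0 < M by exact: lt_le_trans M_ge1.
apply/funext => t; apply/eqP; rewrite -subr_eq0 -normr_le0 leNgt; apply/negP => d0.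
set d := `|u t - v t| in d0.
have B0 : 0 <= B by rewrite !addr_ge0.
(* Comparison with time [t - N] gives [d exp (delta N) <= M B], but for this
   [N] already [d (delta N)] is [M B + 1]. *)
pose N := (M * B + 1) / (delta * d).
have N0 : 0 < N by rewrite divr_gt0 ?mulr_gt0// ltr_wpDl// mulr_ge0// ltW.
have tN : t - N <= t by rewrite gerBl ltW.
have dE : u t - v t = T N (u (t - N) - v (t - N)).
  have [_ ->] := mu_ _ _ tN; have [_ ->] := mv _ _ tN.
  rewrite (semigroupB T_C0); last exact: ltW.
  by rewrite subKr opprD addrACA subrr addr0.
have dle : d <= M * expR (- delta * N) * B.
  rewrite /d dE; apply: le_trans (T_bound _ (ltW N0)) _.
  by rewrite ler_wpM2l// mulr_ge0 ?expR_ge0// ltW.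
have eN : 0 < expR (delta * N) by exact: expR_gt0.
have : d * expR (delta * N) <= M * B.
  rewrite -ler_pdivlMr//; apply: le_trans dle _.
  by rewrite mulNr expRN mulrAC.
have := expR_ge1Dx (delta * N) => e1.
have dN : d * (delta * N) = M * B + 1.
  by rewrite /N; field; rewrite !gt_eqF.
have : d * (1 + delta * N) <= d * expR (delta * N) by rewrite ler_wpM2l// ltW.
rewrite mulrDr mulr1 dN; lra.
Qed.

Variables (f : R -> X) (g : measurableTypeR R -> X) (l C : R).
Hypothesis g_lim : limit_of_simple g.
Hypotheses (l_gt0 : 0 < l) (C_ge0 : 0 <= C) (g_window : window_bounded l C g).
Hypothesis fg : {ae mu, forall t, f t = g t}.

Let semigroup_extend_ae t (D : set (measurableTypeR R)) : D `<=` `]-oo, t] ->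
  {ae mu, forall s, D s -> extend T (t - s) (g s) = T (t - s) (f s)}.
Proof.
move=> Dt; apply: filterS fg => s E /Dt /=; rewrite in_itv/= => st.
by rewrite /extend max_l ?subr_ge0// E.
Qed.

Lemma past_integral_is_solution : mild_solution T f (past_integral T g).
Proof.
move=> a t at_.
have sub : `[a, t]%classic `<=` `]-oo, t]%classic.
  by move=> s; rewrite /= !in_itv/= => /andP[].
have E := semigroup_extend_ae sub; split.
  apply: (bochner_integrable_ae E).
  exact: (extend_integrable_itv T_C0 delta_gt0 M_ge1 T_bound g_lim l_gt0 C_ge0 g_window).
by rewrite -(bochner_integral_ae E) (past_integral_step T_C0 delta_gt0 M_ge1 T_bound g_lim l_gt0 C_ge0 g_window at_).
Qed.

Lemma past_integral_representation t :
  bochner_integrable mu `]-oo, t] (fun s => T (t - s) (f s)) /\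
  past_integral T g t = bochner_integral mu `]-oo, t] (fun s => T (t - s) (f s)).
Proof.
have E := @semigroup_extend_ae t `]-oo, t] (@subset_refl _ _); split.
  apply: (bochner_integrable_ae E).
  exact: (extend_integrable_half_line T_C0 delta_gt0 M_ge1 T_bound g_lim l_gt0 C_ge0 g_window).
exact: (bochner_integral_ae E).
Qed.

Lemma past_integral_bounded : bounded_fun (past_integral T g).
Proof.
exists (M * C / (1 - expR (- delta * l))); split; first exact: num_real.
move=> B ltB t _ /=; apply: le_trans (ltW ltB).
exact: (norm_past_integral_le T_C0 delta_gt0 M_ge1 T_bound g_lim l_gt0 C_ge0 g_window).
Qed.

Lemma past_integral_locally_Lp (p : R) : 1 <= p -> locally_Lp p (past_integral T g).
Proof.
move=> p1; have p0 : 0 < p by exact: lt_le_trans p1.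
have lm := past_integral_limit_of_simple T_C0 delta_gt0 M_ge1 T_bound g_lim l_gt0 C_ge0 g_window.
split.
  by have [s [ss sm]] := lm; exists s; split => //; apply: aeW => t _; exact: sm.
move=> a b; pose B := M * C / (1 - expR (- delta * l)).
have mB t : `|past_integral T g t| <= B.
  exact: (norm_past_integral_le T_C0 delta_gt0 M_ge1 T_bound g_lim l_gt0 C_ge0 g_window).
have B0 : 0 <= B by exact: le_trans (mB 0).
apply: (@le_lt_trans _ _ (\int[mu]_(t in `[a, b]) (B `^ p)%:E)%E).
  apply: ge0_le_integral => //.
  - apply/measurable_EFinP; apply: (measurableT_comp (measurable_powR p)).
    exact: (measurable_norm_limit lm).
  - by move=> t _; rewrite lee_fin; apply: ge0_ler_powR; rewrite ?nnegrE ?(ltW p0).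
rewrite (integral_cst mu (measurable_itv _) (B `^ p)%:E).
rewrite [X in (_ * X)%E]lebesgue_measure_itv/=; case: ifP => _; last by rewrite mule0.
by rewrite -EFinB -EFinM ltry.
Qed.

(** Almost periods of [f] for the tolerance [eps / (2 W)], with [W] bounding
    the mass of the weight, are almost periods of the solution for [eps] with
    the same window length: convolution with the weight multiplies the window
    norm of an increment by at most [W]. *)
Lemma past_integral_weyl (p : R) : 1 <= p -> weyl_almost_periodic p f ->
  weyl_almost_periodic p (past_integral T g).
Proof.
move=> p1 [_ wap]; split; first exact: past_integral_locally_Lp.
move=> eps eps0; pose W := exp_mass delta M.
have W0 : 0 < W by exact: exp_mass_gt0.
pose e := eps / (2 * W).
have e0 : 0 < e by rewrite divr_gt0// mulr_gt0.
have [l' l'0 [k k0 dense]] := wap e e0.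
exists l'; first exact: l'0.
exists k; first exact: k0.
move=> a; have [tau [/= dist ak]] := dense a.
exists tau; split; last exact: ak.
apply: (@le_lt_trans _ _ (W * e)%:E); last first.
  have -> : W * e = eps / 2 by rewrite /e; field; rewrite gt_eqF.
  rewrite lte_fin; lra.
have e0' := ltW e0; have W0' := ltW W0.
apply: weyl_dist_le_window => //; first exact: mulr_ge0.
pose h s := `|g (s + tau) - g s|.
have lgt : limit_of_simple (g \o translate tau : measurableTypeR R -> X).
  exact: (limit_of_simple_comp (@measurable_translate R tau) g_lim).
have mh : measurable_fun setT (h : measurableTypeR R -> R).
  exact: (measurable_norm_limit (limit_of_simpleB lgt g_lim)).
have h0 s : 0 <= h s by exact: normr_ge0.
have D0 : 0 <= l' * e `^ p by rewrite mulr_ge0 ?powR_ge0// ltW.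
have hwin xi : (\int[mu]_(s in `[xi, (xi + l')%R]) (h s `^ p)%:E <= (l' * e `^ p)%:E)%E.
  rewrite /h -(weyl_window_ae _ _ _ _ fg).
  exact: weyl_dist_lt_window.
have hfin t : (exp_conv delta M h t < +oo)%E.
  apply: le_lt_trans (ltry _).
  apply: (exp_weight_window delta_gt0 M_ge1 (C := l' + l' * e `^ p) t mh h0 l'0).
    by rewrite addr_ge0// ltW.
  by move=> xi; exact: (window_Lp_L1 p1).
move=> xi; apply: (@le_trans _ _ (\int[mu]_(t in `[xi, (xi + l')%R])
    (fine (exp_conv delta M h t) `^ p)%:E)%E); last first.
  rewrite powRM// mulrCA.
  exact: (exp_conv_window_Lp delta_gt0 M_ge1 mh h0 p1 D0 hfin hwin).
have lm := past_integral_limit_of_simple T_C0 delta_gt0 M_ge1 T_bound g_lim l_gt0 C_ge0 g_window.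
have lmt : limit_of_simple (past_integral T g \o translate tau : measurableTypeR R -> X).
  exact: (limit_of_simple_comp (@measurable_translate R tau) lm).
apply: ge0_le_integral => //.
- apply/measurable_EFinP; apply: (measurableT_comp (measurable_powR p)).
  exact: (measurable_norm_limit (limit_of_simpleB lmt lm)).
- apply/measurable_EFinP; apply: measurable_funTS.
  apply: (measurableT_comp (measurable_powR p)).
  exact: (measurableT_comp (fine_measurable measurableT) (measurable_exp_conv _ M_ge1 mh h0)).
- move=> t _; rewrite lee_fin.
  have conv0 : (0 <= exp_conv delta M h t)%E.
    by apply: integral_ge0 => s _; rewrite lee_fin mulr_ge0// exp_weight_ge0.
  apply: ge0_ler_powR; rewrite ?nnegrE ?fine_ge0//; first exact: le_trans p1.
  rewrite -lee_fin fineK ?ge0_fin_numE//.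
  exact: (norm_past_integral_translate_le T_C0 delta_gt0 M_ge1 T_bound g_lim l_gt0 C_ge0 g_window).
Qed.

End MildSolutions.

Theorem theorem3p4 (R : realType) (X : completeNormedModType R)
    (DA : set X) (A : X -> X) (T : R -> X -> X) (p : R) (f : R -> X)
    (A_linear : linear_operator DA A)
    (A_generates : generates DA A T)
    (T_stable : exponentially_stable T)
    (p_ge1 : 1 <= p)
    (f_weyl : weyl_almost_periodic p f) :
  exists u : R -> X,
    [/\ unique (fun v : R -> X => bounded_fun v /\ mild_solution T f v) u,
        weyl_almost_periodic p u &
        forall t : R,
          bochner_integrable lebesgue_measure `]-oo, t]
            (fun s : R => T (t - s) (f s)) /\
          u t = bochner_integral lebesgue_measure `]-oo, t]
                  (fun s : R => T (t - s) (f s))].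
Proof.
have [T_C0 _ _] := A_generates.
have [delta [M [delta0 M1 stable]]] := T_stable.
have T_bound t x : 0 <= t -> `|T t x| <= M * expR (- delta * t) * `|x|.
  by move=> t0; apply: op_norm_le; [exact: (semigroup_linear T_C0)|exact: stable].
have [[f_meas _] _] := f_weyl.
have [g g_lim fg] := strongly_measurable_limit f_meas.
have [l [C [l0 C0 g_window]]] := weyl_window_bounded p_ge1 g_lim fg f_weyl.
exists (past_integral T g); split.
- split.
    split; first exact: (past_integral_bounded T_C0 delta0 M1 T_bound g_lim l0 C0 g_window).
    exact: (past_integral_is_solution T_C0 delta0 M1 T_bound g_lim l0 C0 g_window fg).
  move=> v [v_bounded v_mild].
  apply: (bounded_mild_solution_unique T_C0 delta0 M1 T_bound (f := f)) => //.
    exact: (past_integral_bounded T_C0 delta0 M1 T_bound g_lim l0 C0 g_window).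
  exact: (past_integral_is_solution T_C0 delta0 M1 T_bound g_lim l0 C0 g_window fg).
- exact: (past_integral_weyl T_C0 delta0 M1 T_bound g_lim l0 C0 g_window fg).
- exact: (past_integral_representation T_C0 delta0 M1 T_bound g_lim l0 C0 g_window fg).
Qed.
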